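(* Let $A>0$, $K\ne0$, $D\ge2$ with $A^2-4KD^2>0$, let $a_1,b_0$ be numbers, and let $L$ be the limit of the continued fraction $[[0,a_1,A(n-1)],[b_0,-K(Dn-1)(D(n-1)+1)]]$. Then $$L=\frac{b_0}{a_1+A\,f_D(4KD^2/A^2)},\qquad\text{where}\quad f_D(z)=z\,\frac{{}_2F_1'(1/(2D),1/(2D)-1/2;1;z)}{{}_2F_1(1/(2D),1/(2D)+1/2;1;z)},$$ and the following contiguity relation holds: $$f_D(z)=-\frac{z}{2D}+z(1-z)\,\frac{{}_2F_1'(1/(2D),1/(2D)+1/2;1;z)}{{}_2F_1(1/(2D),1/(2D)+1/2;1;z)}.$$
   Context: Continued fraction notation: $[[a_0,a_1,a(n)],[b_0,b(n)]]$ denotes $a_0+b_0/(a_1+b(1)/(a(2)+b(2)/(a(3)+\cdots)))$, i.e. the limit of its convergents; here $a_0=0$, $a(n)=A(n-1)$ for $n\ge2$, $b(n)=-K(Dn-1)(D(n-1)+1)$ for $n\ge1$. ${}_2F_1$ is the Gauss hypergeometric function and ${}_2F_1'$ denotes its derivative with respect to the variable $z$. *)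

(* Defs.v *)
From Stdlib Require Import Reals Factorial.
From Coquelicot Require Import Coquelicot.
Open Scope C_scope.

Fixpoint pochhammer (a : C) (n : nat) : C :=
  match n with
  | O => 1
  | S m => pochhammer a m * (a + INR m)
  end.

(* Meaningful when c is not a nonpositive integer. *)
Definition hyp2F1_coef (a b c : C) (n : nat) : C :=
  pochhammer a n * pochhammer b n / (pochhammer c n * INR (fact n)).

Definition analytic_at (F : C -> C) (z0 : C) : Prop :=
  exists (u : nat -> C) (r : R), (0 < r)%R /\
    forall z : C, (Cmod (z - z0) < r)%R -> is_pseries u (z - z0) (F z).

(* The plane cut along [1, +oo). *)
Definition cut_plane (z : C) : Prop := ~ (Im z = 0%R /\ (1 <= Re z)%R).

(* F is z |-> 2F1(a,b;c;z), principal branch: the Gauss series on the unit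
   disk, continued analytically to the cut plane.  As the cut plane is
   connected this determines F there; values on the cut are unconstrained. *)
Definition is_hyp2F1 (a b c : C) (F : C -> C) : Prop :=
  (forall z : C, (Cmod z < 1)%R -> is_pseries (hyp2F1_coef a b c) z (F z)) /\
  (forall z : C, cut_plane z -> analytic_at F z).

(* x_n = a_n x_(n-1) + b_(n-1) x_(n-2) for n >= 2, with x_0, x_1 given. *)
Fixpoint cf_rec (a b : nat -> C) (x0 x1 : C) (n : nat) : C :=
  match n with
  | O => x0
  | S O => x1
  | S (S k as m) => a n * cf_rec a b x0 x1 m + b m * cf_rec a b x0 x1 k
  end.

(* Numerator and denominator of the n-th convergent
   a_0 + b_0 / (a_1 + b_1 / (a_2 + ... + b_(n-1) / a_n)). *)
Definition cf_num (a b : nat -> C) : nat -> C :=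
  cf_rec a b (a 0%nat) (a 1%nat * a 0%nat + b 0%nat).
Definition cf_den (a b : nat -> C) : nat -> C :=
  cf_rec a b 1 (a 1%nat).

(* Convergents with vanishing denominator (value infinity) are excluded from
   some rank on, since division in C is total. *)
Definition is_cf_limit (a b : nat -> C) (L : C) : Prop :=
  eventually (fun n => cf_den a b n <> 0) /\
  filterlim (fun n => cf_num a b n / cf_den a b n) eventually (locally L).

Definition cf_a (A : R) (a1 : C) (n : nat) : C :=
  match n with
  | O => 0
  | S O => a1
  | S m => RtoC (A * INR m)
  end.

Definition cf_b (K D : R) (b0 : C) (n : nat) : C :=
  match n with
  | O => b0
  | S m => RtoC (- K * (D * INR n - 1) * (D * INR m + 1))
  end.

(* F and G stand for 2F1(1/(2D),1/(2D)+1/2;1;.) and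
   2F1(1/(2D),1/(2D)-1/2;1;.) respectively. *)
Definition f_D (F G : C -> C) (z : C) : C := z * (C_derive G z / F z).

(* Main.v *)
Require Import Defs.
From Stdlib Require Import Reals Lra Lia Classical Factorial.
From Coquelicot Require Import Coquelicot.

(** Put d = 1/D and let p, q be the roots of X^2 - A X + K D^2, with |q| < p. Numerators and
    denominators of the convergents solve
    y(k+2) = (p + q) (k+1) y(k+1) - p q (k+1-d) (k+d) y(k), and a1 and b0 only enter through the
    initial values, so the limit is read off the minimal solution m: the solutions y, w with
    initial values (0, 1), (1, 0) satisfy w(n)/y(n) -> - m(1)/m(0). The minimal solution is
    explicit: m(n) = q^n (1-d)_n S_n(q/p), where S_n(t) is the n-th Laurent coefficient of
    (1-u)^(-d) (1-t/u)^(-d). On the other side, the two first order contiguity relations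
    z G' = (b-1)(F-G) and G' = (1-z) F' - a F (a = d/2, b = (d+1)/2) hold near 0 by comparing coefficients, hence on the
    cut plane by the identity theorem. Along x = 4t/(1+t)^2 with t = q/p they become a linear
    system also solved by S_0, S_1, whence F = (1+t)^d S_0 > 0 and
    A x G'/F = - m(1)/m(0). *)

Open Scope C_scope.

(** * Complex power series *)

(** The argument x = 4 K D^2 / A^2 is below 1 but can be any negative number when K < 0, so
    identities read off the Gauss series must be continued outside the unit disk. The S_n come from
    their generating function: Phi(u) = (1-u)^(-d) (1-t/u)^(-d) satisfies u (1-u) (u-t) Phi' = d
    (u^2 - t) Phi, and comparing powers of u gives a three-term recurrence, which the factor q^n
    (1-d)_n turns into that of the convergents. Moreover S_0(t) = 2F1(d, d; 1; t), so F = (1+t)^d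
    S_0 is a classical quadratic transformation; proving it through a first order system yields G'/F
    in terms of S_1/S_0 at the same time. That system is singular at t = 0, so uniqueness is
    obtained from a Wronskian, with mere continuity at 0. Minimality takes two arguments: for q > 0
    all quantities are positive and the Casoratian controls y/m; for q < 0 the factor q^n
    alternates, but the recurrence has positive coefficients and y can be bounded below by
    comparison. *)

Lemma is_series_C_iff (c : nat -> C) (l : C) :
  @is_series C_AbsRing C_NormedModule c l <->
  is_series (fun n => Re (c n)) (Re l) /\ is_series (fun n => Im (c n)) (Im l).
Proof.
assert (HR : forall n, Re (sum_n c n) = sum_n (fun k => Re (c k)) n).
{ induction n as [|n IH]; [now rewrite !sum_O|].
  now rewrite !sum_Sn, <- IH. }
assert (HI : forall n, Im (sum_n c n) = sum_n (fun k => Im (c k)) n).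
{ induction n as [|n IH]; [now rewrite !sum_O|].
  now rewrite !sum_Sn, <- IH. }
unfold is_series; split.
- intros H; split; apply filterlim_locally; intros eps;
  generalize (proj1 (filterlim_locally _ _) H eps); apply filter_imp; intros n [Hn1 Hn2].
  + now rewrite <- HR.
  + now rewrite <- HI.
- intros [H1 H2]; apply filterlim_locally; intros eps.
  generalize (filter_and _ _ (proj1 (filterlim_locally _ _) H1 eps)
    (proj1 (filterlim_locally _ _) H2 eps)); apply filter_imp; intros n [Hn1 Hn2].
  rewrite <- HR in Hn1; rewrite <- HI in Hn2; now split.
Qed.

Lemma pow_n_Cpow (z : C) (n : nat) : pow_n (K := C_AbsRing) z n = z ^ n.
Proof. induction n as [|n IH]; [reflexivity|]; simpl; now rewrite IH. Qed.

Lemma is_pseries_C_iff (a : nat -> C) (z l : C) :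
  is_pseries a z l <-> @is_series C_AbsRing C_NormedModule (fun n => a n * z ^ n) l.
Proof.
assert (E : forall n, scal (pow_n (K := C_AbsRing) z n) (a n) = a n * z ^ n).
{ intros n; rewrite pow_n_Cpow; apply Cmult_comm. }
split; intros H; [|unfold is_pseries]; eapply is_series_ext; try exact H;
  intros n; [|symmetry]; apply E.
Qed.

Lemma Cmod_le_Re_Im (c : C) : (Cmod c <= Rabs (Re c) + Rabs (Im c))%R.
Proof.
destruct c as [x y]; unfold Re, Im; simpl fst; simpl snd.
replace (x, y) with (RtoC x + Ci * RtoC y)%C
  by (unfold Ci, RtoC; apply injective_projections; simpl; ring).
eapply Rle_trans; [apply Cmod_triangle|].
rewrite Cmod_mult, Cmod_Ci, !Cmod_R; lra.
Qed.

Lemma Im_le_Cmod (c : C) : (Rabs (Im c) <= Cmod c)%R.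
Proof. eapply Rle_trans; [apply Rmax_r|apply Rmax_Cmod]. Qed.

Lemma is_pseries_C_bounded (a : nat -> C) (z l : C) :
  is_pseries a z l -> exists M : R, forall n, (Cmod (a n * z ^ n) <= M)%R.
Proof.
intros H; apply is_pseries_C_iff, is_series_C_iff in H; destruct H as [H1 H2].
assert (B : forall b s, is_series b s -> exists M, forall n : nat, (Rabs (b n) <= M)%R).
{ intros b s Hb.
  assert (Hl : is_lim_seq b 0) by (apply ex_series_lim_0; now exists s).
  destruct (filterlim_bounded (K := R_AbsRing) (V := R_NormedModule) b) as [M HM].
  - exists 0%R; exact Hl.
  - exists M; exact HM. }
destruct (B _ _ H1) as [M1 HM1], (B _ _ H2) as [M2 HM2].
exists (M1 + M2)%R; intros n; eapply Rle_trans; [|apply Rplus_le_compat; auto].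
apply Cmod_le_Re_Im.
Qed.

Lemma is_pseries_C_0 (a : nat -> C) : is_pseries a (RtoC 0) (a O).
Proof.
apply is_pseries_C_iff, (is_series_decr_1 (K := C_AbsRing)).
replace (plus _ _) with (zero : C_NormedModule).
2: { change (zero : C_NormedModule) with (RtoC 0); change plus with Cplus;
     change opp with Copp; simpl; ring. }
apply is_series_C_iff; split; apply (is_series_ext (fun _ => 0%R)).
1, 3: intros n; simpl; rewrite ?Cpow_S; simpl; destruct (a (S n)); simpl; ring.
all: apply (filterlim_ext (fun _ => 0%R)); [|apply filterlim_const].
all: intros n; now rewrite sum_n_const, Rmult_0_r.
Qed.

(* Terms are at most [M (|w| / |w0|)^n], and the sum of the geometric series from rank 1 is at most [2 M |w| / |w0|]. *)
Lemma pseries_C_lipschitz_0 (a : nat -> C) (w0 l0 : C) :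
  w0 <> 0 -> is_pseries a w0 l0 ->
  exists M : R, (0 <= M)%R /\ forall w l : C, (Cmod w <= Cmod w0 / 2)%R -> is_pseries a w l ->
    (Cmod (l - a O) <= M * Cmod w)%R.
Proof.
intros Hw0 H0; destruct (is_pseries_C_bounded _ _ _ H0) as [M HM].
assert (P0 : (0 < Cmod w0)%R) by now apply Cmod_gt_0.
assert (M0 : (0 <= M)%R) by (eapply Rle_trans; [apply Cmod_ge_0|apply (HM O)]).
assert (Pinv : (0 <= / Cmod w0)%R) by (left; now apply Rinv_0_lt_compat).
(* Twice the 2 of the geometric sum: real and imaginary parts are bounded separately and then
   added. *)
exists (4 * M / Cmod w0)%R; split.
{ unfold Rdiv; apply Rmult_le_pos; lra. }
intros w l Hw H.
set (q := (Cmod w / Cmod w0)%R).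
assert (Hq0 : (0 <= q)%R) by (apply Rmult_le_pos; [apply Cmod_ge_0|exact Pinv]).
assert (Hq : (q <= 1 / 2)%R).
{ unfold q; apply Rle_div_l; [exact P0|lra]. }
assert (Ht : forall n, (Cmod (a (S n) * w ^ S n) <= M * q * q ^ n)%R).
{ intros n; rewrite Rmult_assoc; change (q * q ^ n)%R with (q ^ S n)%R.
  replace (a (S n) * w ^ S n) with ((a (S n) * w0 ^ S n) * (w / w0) ^ S n).
  2: { unfold Cdiv; rewrite Cpow_mult_l, Cpow_inv by exact Hw0.
       field; now apply Cpow_nz. }
  rewrite Cmod_mult, Cmod_pow, Cmod_div by exact Hw0.
  apply Rmult_le_compat_r; [now apply pow_le|apply HM]. }
assert (Hg : is_series (fun n => M * q * q ^ n)%R (M * q * / (1 - q))%R).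
{ apply (is_series_scal_l (K := R_AbsRing) (V := R_NormedModule)), is_series_geom.
  rewrite Rabs_pos_eq; lra. }
assert (Hb : forall (b : nat -> R) s, is_series b s ->
  (forall n, Rabs (b n) <= M * q * q ^ n)%R -> (Rabs s <= M * q * / (1 - q))%R).
{ intros b s Hs Hn; rewrite <- (is_series_unique _ _ Hs), <- (is_series_unique _ _ Hg).
  eapply Rle_trans; [apply Series_Rabs|apply Series_le].
  - apply (ex_series_le (K := R_AbsRing) (V := R_CompleteNormedModule)) with (2 := ex_intro _ _ Hg).
    intros n; unfold norm; simpl; unfold abs; simpl; rewrite Rabs_Rabsolu; apply Hn.
  - intros n; split; [apply Rabs_pos|apply Hn].
  - now eexists; apply Hg. }
assert (Hs : @is_series C_AbsRing C_NormedModule (fun n => a (S n) * w ^ S n) (l - a O)).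
{ apply (is_series_incr_1 (K := C_AbsRing) (V := C_NormedModule) (fun n => a n * w ^ n)).
  replace (plus _ _) with l; [now apply is_pseries_C_iff|].
  assert (E : @eq C l (l - a O + a O * 1)) by ring; exact E. }
apply is_series_C_iff in Hs; destruct Hs as [Hs1 Hs2].
apply Hb in Hs1; [|intros n; eapply Rle_trans; [apply re_le_Cmod|apply Ht]].
apply Hb in Hs2; [|intros n; eapply Rle_trans; [apply Im_le_Cmod|apply Ht]].
set (c := (l - a O)%C) in *.
assert (Hc := Cmod_le_Re_Im c).
assert (Hi : (/ (1 - q) <= 2)%R).
{ replace 2%R with (/ (1 / 2))%R by field; apply Rinv_le_contravar; lra. }
replace (4 * M / Cmod w0 * Cmod w)%R with (M * q * 2 + M * q * 2)%R
  by (unfold q; field; lra).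
assert (Hmq : (0 <= M * q)%R) by now apply Rmult_le_pos.
assert (M * q * / (1 - q) <= M * q * 2)%R by now apply Rmult_le_compat_l.
lra.
Qed.

Lemma is_pseries_C_unique (a : nat -> C) (w l l' : C) :
  is_pseries a w l -> is_pseries a w l' -> l = l'.
Proof.
rewrite !is_pseries_C_iff, !is_series_C_iff; intros [H1 H2] [H3 H4].
apply injective_projections; unfold Re, Im in *.
- now rewrite <- (is_series_unique _ _ H1), <- (is_series_unique _ _ H3).
- now rewrite <- (is_series_unique _ _ H2), <- (is_series_unique _ _ H4).
Qed.

Lemma is_pseries_C_decr (a : nat -> C) (w l : C) :
  w <> 0 -> is_pseries a w l -> is_pseries (fun n => a (S n)) w ((l - a O) / w).
Proof.
intros Hw H; unfold Cdiv; rewrite Cmult_comm.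
refine (is_pseries_decr_1 (K := C_AbsRing) (V := C_NormedModule) a w (/ w) l _ H).
now apply Cinv_l.
Qed.

(** The difference quotient at [z0] is the sum of the shifted series, to which
    [pseries_C_lipschitz_0] applies; multiplying back by [w] gives a quadratic remainder. *)
Lemma pseries_C_expansion (F : C -> C) (z0 : C) (u : nat -> C) (r : R) :
  (0 < r)%R ->
  (forall z, (Cmod (z - z0) < r)%R -> is_pseries u (z - z0) (F z)) ->
  exists M rho : R, (0 <= M)%R /\ (0 < rho)%R /\ forall w : C, (Cmod w < rho)%R ->
    (Cmod (F (z0 + w)%C - F z0 - u 1%nat * w) <= M * Cmod w ^ 2)%R.
Proof.
intros Hr H.
assert (H0 : F z0 = u O).
{ apply (is_pseries_C_unique u 0); [|apply is_pseries_C_0].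
  replace (RtoC 0) with (z0 - z0) by ring; apply H.
  replace (z0 - z0) with (RtoC 0) by ring; now rewrite Cmod_0. }
assert (H' : forall w : C, w <> 0 -> (Cmod w < r)%R ->
  is_pseries (fun n => u (S n)) w ((F (z0 + w)%C - F z0) / w)).
{ intros w Hw Hwr; rewrite H0; apply is_pseries_C_decr; [exact Hw|].
  replace w with (z0 + w - z0) at 1 by ring; apply H.
  now replace (z0 + w - z0) with w by ring. }
assert (Hm : Cmod (RtoC (r / 2)) = (r / 2)%R) by (rewrite Cmod_R; apply Rabs_pos_eq; lra).
assert (Hn : RtoC (r / 2) <> 0) by (intros E; apply RtoC_inj in E; lra).
destruct (pseries_C_lipschitz_0 _ _ _ Hn (H' _ Hn ltac:(rewrite Hm; lra)))
  as [M [HM0 HM]].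
(* The reference point is [r / 2], and the Lipschitz bound holds up to half its modulus. *)
exists M, (r / 4)%R; repeat split; [exact HM0|lra|].
intros w Hw; destruct (Ceq_dec w 0) as [->|Hw0].
{ replace (_ - _ - _) with (RtoC 0) by (rewrite Cplus_0_r; ring).
  rewrite Cmod_0; lra. }
replace (F (z0 + w)%C - F z0 - u 1%nat * w) with (((F (z0 + w) - F z0) / w - u 1%nat) * w)
  by (field; exact Hw0).
rewrite Cmod_mult; simpl; rewrite Rmult_1_r, <- Rmult_assoc.
apply Rmult_le_compat_r; [apply Cmod_ge_0|].
apply HM; [rewrite Hm; lra|apply H'; [exact Hw0|lra]].
Qed.

Lemma C_derive_expansion (F : C -> C) (z0 d : C) (M rho : R) :
  (0 <= M)%R -> (0 < rho)%R ->
  (forall w : C, (Cmod w < rho)%R -> (Cmod (F (z0 + w)%C - F z0 - d * w) <= M * Cmod w ^ 2)%R) ->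
  C_derive F z0 = d.
Proof.
intros HM Hr H; apply is_C_lim_unique, filterlim_locally; intros eps.
(* The halves compensate for the balls of [C] being products of real balls: within one of radius
   delta, the modulus is only known to be below 2 delta. [M + 1] keeps the denominator positive. *)
assert (Hd : (0 < Rmin (rho / 2) (eps / (2 * (M + 1))))%R).
{ apply Rmin_glb_lt; [lra|]; apply Rdiv_lt_0_compat; [apply cond_pos|lra]. }
exists (mkposreal _ Hd); intros z [B1 B2] Hz; change C in z.
apply C_NormedModule_mixin_compat1.
change (minus ((F z - F z0) / (z - z0)) d) with ((F z - F z0) / (z - z0) - d).
assert (Hw0 : z - z0 <> 0) by (intros E; apply Hz; replace z with (z - z0 + z0) by ring; rewrite E; apply Cplus_0_l).
set (w := z - z0) in *; assert (Ez : z = z0 + w) by (unfold w; ring).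
assert (Hc : (Cmod w < 2 * Rmin (rho / 2) (eps / (2 * (M + 1))))%R).
{ eapply Rle_lt_trans; [apply Cmod_le_Re_Im|].
  change (Rabs (Re w)) with (Rabs (fst z - fst z0)%R).
  change (Rabs (Im w)) with (Rabs (snd z - snd z0)%R).
  change (Rabs (fst z - fst z0) < Rmin (rho / 2) (eps / (2 * (M + 1))))%R in B1.
  change (Rabs (snd z - snd z0) < Rmin (rho / 2) (eps / (2 * (M + 1))))%R in B2.
  lra. }
assert (Hc1 := Rmin_l (rho / 2) (eps / (2 * (M + 1)))).
assert (Hc2 := Rmin_r (rho / 2) (eps / (2 * (M + 1)))).
assert (P : (0 < Cmod w)%R) by now apply Cmod_gt_0.
replace ((F z - F z0) / w - d) with ((F (z0 + w)%C - F z0 - d * w) / w)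
  by (rewrite Ez; field; exact Hw0).
rewrite Cmod_div by exact Hw0.
apply Rlt_div_l; [exact P|].
eapply Rle_lt_trans; [apply H; lra|].
simpl; rewrite Rmult_1_r, <- Rmult_assoc; apply Rmult_lt_compat_r; [exact P|].
assert (Hc3 : (Cmod w < eps / (M + 1))%R).
{ replace (eps / (M + 1))%R with (2 * (eps / (2 * (M + 1))))%R by (field; lra); lra. }
apply Rlt_div_r in Hc3; [|lra].
assert (0 <= M * Cmod w)%R by (apply Rmult_le_pos; lra); nra.
Qed.

Lemma analytic_at_expansion (F : C -> C) (z0 : C) :
  analytic_at F z0 ->
  exists M rho : R, (0 <= M)%R /\ (0 < rho)%R /\ forall w : C, (Cmod w < rho)%R ->
    (Cmod (F (z0 + w)%C - F z0 - C_derive F z0 * w) <= M * Cmod w ^ 2)%R.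
Proof.
intros [u [r [Hr H]]].
destruct (pseries_C_expansion F z0 u r Hr H) as [M [rho [HM [Hrho HF]]]].
exists M, rho; rewrite (C_derive_expansion F z0 _ M rho HM Hrho HF); auto.
Qed.

(** [p] stands for [Re] or [Im]. Restricting to a real line makes the real theory of derivatives and
    power series available for complex functions. *)
Lemma is_derive_line_component (F : C -> C) (z w : C) (p : C -> R) (t : R) :
  (forall c d, p (c - d) = (p c - p d)%R) ->
  (forall (s : R) c, p (RtoC s * c) = (s * p c)%R) ->
  (forall c, Rabs (p c) <= Cmod c)%R ->
  analytic_at F (z + RtoC t * w) ->
  is_derive (fun s => p (F (z + RtoC s * w))) t (p (w * C_derive F (z + RtoC t * w))).
Proof.
intros pB pM pC HF; destruct (analytic_at_expansion _ _ HF) as [M [rho [HM [Hr H]]]].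
apply is_derive_Reals; intros eps Heps.
set (K := (M * Cmod w ^ 2 + 1)%R).
assert (HK0 : (0 <= M * Cmod w ^ 2)%R) by (apply Rmult_le_pos; [lra|apply pow2_ge_0]).
assert (Hw0 := Cmod_ge_0 w).
assert (Hd : (0 < Rmin (rho / (Cmod w + 1)) (eps / K))%R).
{ apply Rmin_glb_lt; apply Rdiv_lt_0_compat; unfold K; lra. }
exists (mkposreal _ Hd); simpl; intros h Hh0 Hh.
assert (Hh1 := Rlt_le_trans _ _ _ Hh (Rmin_l _ _)).
assert (Hh2 := Rlt_le_trans _ _ _ Hh (Rmin_r _ _)).
assert (Ph : (0 < Rabs h)%R) by now apply Rabs_pos_lt.
set (zt := z + RtoC t * w) in *.
replace (z + RtoC (t + h) * w) with (zt + RtoC h * w)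
  by (unfold zt; rewrite RtoC_plus; ring).
replace ((p (F (zt + RtoC h * w)%C) - p (F zt)) / h - p (w * C_derive F zt)%C)%R
  with (p (F (zt + RtoC h * w)%C - F zt - C_derive F zt * (RtoC h * w))%C / h)%R.
2: { rewrite !pB; replace (C_derive F zt * (RtoC h * w)) with (RtoC h * (w * C_derive F zt))
       by ring; rewrite pM; field; exact Hh0. }
unfold Rdiv; rewrite Rabs_mult, Rabs_inv; apply Rlt_div_l; [exact Ph|].
eapply Rle_lt_trans; [eapply Rle_trans; [apply pC|apply H]|].
- rewrite Cmod_mult, Cmod_R.
  apply Rlt_div_r in Hh1; [nra|lra].
- rewrite Cmod_mult, Cmod_R, Rpow_mult_distr.
  apply Rlt_div_r in Hh2; [|unfold K; lra]; unfold K in Hh2.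
  replace (M * (Rabs h ^ 2 * Cmod w ^ 2))%R with (Rabs h * (M * Cmod w ^ 2) * Rabs h)%R by ring.
  apply Rmult_lt_compat_r; [exact Ph|]; nra.
Qed.

Lemma is_derive_Re_line (F : C -> C) (z w : C) (t : R) :
  analytic_at F (z + RtoC t * w) ->
  is_derive (fun s => Re (F (z + RtoC s * w)%C)) t (Re (w * C_derive F (z + RtoC t * w))).
Proof.
apply is_derive_line_component.
- reflexivity.
- intros s [x y]; unfold RtoC, Re, Im; simpl; ring.
- apply re_le_Cmod.
Qed.

Lemma is_derive_Im_line (F : C -> C) (z w : C) (t : R) :
  analytic_at F (z + RtoC t * w) ->
  is_derive (fun s => Im (F (z + RtoC s * w))) t (Im (w * C_derive F (z + RtoC t * w))).
Proof.
apply is_derive_line_component.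
- reflexivity.
- intros s [x y]; unfold RtoC, Re, Im; simpl; ring.
- apply Im_le_Cmod.
Qed.

(** Termwise differentiation by reduction to the real case: s |-> p (F (z0 + s w)) is a real power
    series with coefficients p (u n w^n) and radius above 1, and its derivative at s = 1 is computed
    both along the line and term by term. *)
Lemma is_series_C_derive_component (F : C -> C) (z0 w : C) (u : nat -> C) (r : R) (p : C -> R) :
  (forall (s : R) c, p (RtoC s * c) = (s * p c)%R) ->
  (forall c l, @is_series C_AbsRing C_NormedModule c l -> is_series (fun n => p (c n)) (p l)) ->
  (forall z t, analytic_at F (z + RtoC t * w) ->
     is_derive (fun s => p (F (z + RtoC s * w))) t (p (w * C_derive F (z + RtoC t * w)))) ->
  (forall z : C, (Cmod (z - z0) < r)%R -> is_pseries u (z - z0) (F z)) ->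
  analytic_at F (z0 + w) -> w <> 0 -> (Cmod w < r)%R ->
  is_series (fun n => p (RtoC (INR (S n)) * u (S n) * w ^ S n)) (p (w * C_derive F (z0 + w))).
Proof.
intros pM pS pD HF HA Hw0 Hw.
assert (P : (0 < Cmod w)%R) by now apply Cmod_gt_0.
set (R1 := (r / Cmod w)%R).
assert (HR1 : (1 < R1)%R) by (apply Rlt_div_r; lra).
set (a := fun n => p (u n * w ^ n)).
assert (Ha : forall t : R, (Rabs t < R1)%R -> is_pseries a t (p (F (z0 + RtoC t * w)))).
{ intros t Ht; apply is_pseries_R.
  assert (H : is_pseries u (RtoC t * w) (F (z0 + RtoC t * w))).
  { replace (RtoC t * w) with (z0 + RtoC t * w - z0) at 1 by ring; apply HF.
    replace (z0 + RtoC t * w - z0) with (RtoC t * w) by ring.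
    rewrite Cmod_mult, Cmod_R; apply Rlt_div_r in Ht; lra. }
  apply is_pseries_C_iff, pS in H.
  eapply is_series_ext; [|exact H]; intros n; unfold a; cbv beta.
  rewrite Cpow_mult_l, <- RtoC_pow, Rmult_comm, <- pM; f_equal; ring. }
(* A point strictly between 1 and [R1]: convergence there puts 1 strictly inside the disk of
   convergence. *)
set (t1 := ((1 + R1) / 2)%R).
assert (HCV : Rbar_lt 1 (CV_radius a)).
{ apply Rbar_lt_le_trans with t1; [unfold t1; simpl; lra|].
  apply Rbar_not_lt_le; intros Hlt.
  apply (CV_disk_outside a t1).
  - rewrite Rabs_pos_eq by (unfold t1; lra); exact Hlt.
  - apply ex_series_lim_0; eexists; apply is_pseries_R, Ha.
    rewrite Rabs_pos_eq; unfold t1; lra. }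
assert (HCV' : Rbar_lt (Rabs 1) (CV_radius a)) by now rewrite Rabs_R1.
assert (Hd := is_derive_PSeries a 1 HCV').
assert (Hd' : is_derive (PSeries a) 1 (p (w * C_derive F (z0 + RtoC 1 * w)))).
{ apply is_derive_ext_loc with (fun s => p (F (z0 + RtoC s * w))).
  - assert (He : (0 < R1 - 1)%R) by lra.
    exists (mkposreal _ He); intros t Ht; symmetry; apply is_pseries_unique, Ha.
    change (Rabs (t - 1) < R1 - 1)%R in Ht.
    apply Rabs_def2 in Ht; apply Rabs_def1; lra.
  - apply pD; now rewrite Cmult_1_l. }
apply is_derive_unique in Hd; apply is_derive_unique in Hd'.
rewrite Cmult_1_l in Hd'; rewrite <- Hd', Hd.
assert (Hs : is_pseries (PS_derive a) 1 (PSeries (PS_derive a) 1)).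
{ apply PSeries_correct, CV_radius_inside; now rewrite CV_radius_derive. }
apply is_pseries_R in Hs; eapply is_series_ext; [|exact Hs].
intros n; cbv beta; unfold PS_derive, a; rewrite pow1, Rmult_1_r, <- Cmult_assoc.
symmetry; apply pM.
Qed.

Lemma is_pseries_C_derive (F : C -> C) (z0 : C) (u : nat -> C) (r : R) :
  (forall z : C, (Cmod (z - z0) < r)%R -> is_pseries u (z - z0) (F z)) ->
  (forall z : C, (Cmod (z - z0) < r)%R -> analytic_at F z) ->
  forall z : C, (Cmod (z - z0) < r)%R ->
    is_pseries (fun n => RtoC (INR (S n)) * u (S n)) (z - z0) (C_derive F z).
Proof.
intros HF HA z Hz; set (w := z - z0) in *.
assert (Ez : z = z0 + w) by (unfold w; ring); rewrite Ez in *; clearbody w; clear z Ez.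
(* For [w = 0] the line through [z0] degenerates, and the derivative is read off the second order
   expansion instead. *)
destruct (Ceq_dec w 0) as [->|Hw0].
{ assert (Hr : (0 < r)%R) by (rewrite Cmod_0 in Hz; exact Hz).
  destruct (pseries_C_expansion F z0 u r Hr HF) as [M [rho [HM [Hrho He]]]].
  rewrite Cplus_0_r, (C_derive_expansion F z0 _ M rho HM Hrho He).
  replace (u 1%nat) with (RtoC (INR 1) * u 1%nat) by (simpl; ring).
  apply (is_pseries_C_0 (fun n => RtoC (INR (S n)) * u (S n))). }
assert (HA' : analytic_at F (z0 + w)).
{ apply HA; now replace (z0 + w - z0) with w by ring. }
assert (H : @is_series C_AbsRing C_NormedModule
  (fun n => RtoC (INR (S n)) * u (S n) * w ^ S n) (w * C_derive F (z0 + w))).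
{ apply is_series_C_iff; split;
    apply (is_series_C_derive_component F z0 w u r); auto.
  - intros s [x y]; unfold RtoC, Re, Im; simpl; ring.
  - intros c l Hc; now apply is_series_C_iff in Hc.
  - intros z t; apply is_derive_Re_line.
  - intros s [x y]; unfold RtoC, Re, Im; simpl; ring.
  - intros c l Hc; now apply is_series_C_iff in Hc.
  - intros z t; apply is_derive_Im_line. }
apply is_pseries_C_iff.
apply (is_series_scal_l (K := C_AbsRing) (V := C_NormedModule) (/ w)) in H.
replace (C_derive F (z0 + w)) with (/ w * (w * C_derive F (z0 + w))) by (field; exact Hw0).
eapply is_series_ext; [|exact H]; intros n; cbv beta.
change (@eq C (/ w * (RtoC (INR (S n)) * u (S n) * w ^ S n)) (RtoC (INR (S n)) * u (S n) * w ^ n)).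
rewrite Cpow_S; field; exact Hw0.
Qed.

(** * Analytic functions on the cut plane *)

Lemma open_cut_plane (z : C) :
  cut_plane z -> exists r : R, (0 < r)%R /\ forall z' : C, (Cmod (z' - z) < r)%R -> cut_plane z'.
Proof.
intros Hz; destruct (Req_dec (Im z) 0) as [Hi|Hi].
- assert (Hr : (Re z < 1)%R) by (apply Rnot_le_lt; intros Hr; now apply Hz).
  exists (1 - Re z)%R; split; [lra|]; intros z' Hz' [_ H].
  assert (H1 := re_le_Cmod (z' - z)%C).
  change (Re (z' - z)%C) with (Re z' - Re z)%R in H1.
  assert (H2 := Rle_abs (Re z' - Re z)); lra.
- exists (Rabs (Im z)); split; [now apply Rabs_pos_lt|]; intros z' Hz' [H _].
  assert (H1 := Im_le_Cmod (z' - z)%C).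
  change (Im (z' - z)%C) with (Im z' - Im z)%R in H1.
  rewrite H, Rminus_0_l, Rabs_Ropp in H1; lra.
Qed.

Lemma cut_plane_scal (z : C) (t : R) :
  (0 <= t <= 1)%R -> cut_plane z -> cut_plane (RtoC t * z).
Proof.
intros Ht Hz [Hi Hr]; apply Hz.
destruct z as [x y]; unfold RtoC, Re, Im in *; simpl in *.
assert (t <> 0)%R by (intros ->; lra).
split; [apply (Rmult_eq_reg_l t); lra|nra].
Qed.

Lemma analytic_at_derive (F : C -> C) :
  (forall z, cut_plane z -> analytic_at F z) ->
  forall z, cut_plane z -> analytic_at (C_derive F) z.
Proof.
intros HF z0 Hz0; destruct (HF z0 Hz0) as [u [r [Hr Hu]]].
destruct (open_cut_plane z0 Hz0) as [r' [Hr' Hcut]].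
exists (fun n => RtoC (INR (S n)) * u (S n)), (Rmin r r'); split; [now apply Rmin_glb_lt|].
apply is_pseries_C_derive.
- intros z Hz; apply Hu; eapply Rlt_le_trans; [exact Hz|apply Rmin_l].
- intros z Hz; apply HF, Hcut; eapply Rlt_le_trans; [exact Hz|apply Rmin_r].
Qed.

Lemma analytic_at_plus (F G : C -> C) (z0 : C) :
  analytic_at F z0 -> analytic_at G z0 -> analytic_at (fun z => F z + G z) z0.
Proof.
intros [u [r [Hr Hu]]] [v [r' [Hr' Hv]]].
exists (fun n => u n + v n), (Rmin r r'); split; [now apply Rmin_glb_lt|]; intros z Hz.
apply (is_pseries_plus (K := C_AbsRing) (V := C_NormedModule)).
- apply Hu; eapply Rlt_le_trans; [exact Hz|apply Rmin_l].
- apply Hv; eapply Rlt_le_trans; [exact Hz|apply Rmin_r].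
Qed.

Lemma analytic_at_scal (F : C -> C) (c z0 : C) :
  analytic_at F z0 -> analytic_at (fun z => c * F z) z0.
Proof.
intros [u [r [Hr Hu]]]; exists (fun n => c * u n), r; split; [exact Hr|]; intros z Hz.
refine (is_pseries_scal (K := C_AbsRing) (V := C_NormedModule) c u _ _ _ (Hu z Hz)).
apply Cmult_comm.
Qed.

Lemma analytic_at_mul_id (F : C -> C) (z0 : C) :
  analytic_at F z0 -> analytic_at (fun z => z * F z) z0.
Proof.
intros HF; destruct (analytic_at_scal F z0 z0 HF) as [v [r' [Hr' Hv]]].
destruct HF as [u [r [Hr Hu]]].
exists (PS_plus (K := C_AbsRing) (V := C_NormedModule) v (PS_incr_1 u)), (Rmin r r').
split; [now apply Rmin_glb_lt|]; intros z Hz.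
replace (z * F z) with (z0 * F z + (z - z0) * F z) by ring.
apply (is_pseries_plus (K := C_AbsRing) (V := C_NormedModule)).
- apply Hv; eapply Rlt_le_trans; [exact Hz|apply Rmin_r].
- apply (is_pseries_incr_1 (K := C_AbsRing) (V := C_NormedModule)), Hu.
  eapply Rlt_le_trans; [exact Hz|apply Rmin_l].
Qed.

(** Zeros accumulating at 0 suffice: at each of them |a 0| <= M |w|, so [a 0] vanishes, and dividing
    by [w] passes to the shifted series with the same zeros. *)
Lemma pseries_C_coef_0 (a : nat -> C) :
  (forall eps : R, (0 < eps)%R ->
     exists w : C, w <> 0 /\ (Cmod w < eps)%R /\ is_pseries a w (RtoC 0)) ->
  forall n, a n = 0.
Proof.
assert (H0 : forall b : nat -> C,
  (forall eps : R, (0 < eps)%R ->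
     exists w : C, w <> 0 /\ (Cmod w < eps)%R /\ is_pseries b w (RtoC 0)) -> b O = 0).
{ intros b H; destruct (H 1%R Rlt_0_1) as [w0 [Hw0 [_ Hs]]].
  destruct (pseries_C_lipschitz_0 b w0 0 Hw0 Hs) as [M [HM0 HM]].
  assert (P0 : (0 < Cmod w0)%R) by now apply Cmod_gt_0.
  apply Cmod_eq_0, Rle_antisym; [|apply Cmod_ge_0].
  apply le_epsilon; intros eps Heps; rewrite Rplus_0_l.
  assert (He : (0 < Rmin (Cmod w0 / 2) (eps / (M + 1)))%R).
  { apply Rmin_glb_lt; [lra|apply Rdiv_lt_0_compat; lra]. }
  destruct (H _ He) as [w [Hw [Hwe Hws]]].
  assert (H1 := Rlt_le_trans _ _ _ Hwe (Rmin_l _ _)).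
  assert (H2 := Rlt_le_trans _ _ _ Hwe (Rmin_r _ _)).
  specialize (HM w 0 ltac:(lra) Hws).
  replace (0 - b O) with (- b O) in HM by ring; rewrite Cmod_opp in HM.
  apply Rlt_div_r in H2; [|lra].
  assert (Hw0' := Cmod_ge_0 w); nra. }
intros H n; revert a H; induction n as [|n IH]; intros a H; [now apply H0|].
apply (IH (fun k => a (S k))); intros eps Heps.
destruct (H eps Heps) as [w [Hw [Hwe Hws]]]; exists w; repeat split; auto.
apply is_pseries_C_decr in Hws; [|exact Hw].
rewrite (H0 a H) in Hws.
now replace ((0 - 0) / w) with (RtoC 0) in Hws by (field; exact Hw).
Qed.

(** The cut plane is star-shaped about 0, so continuation along the segment from 0 to [z] is enough:
    at the supremum [m] of the parameters up to which [H] vanishes, the zeros just before [m] kill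
    the local expansion, hence [H] vanishes beyond [m] as well unless [m = 1]. *)
Lemma cut_plane_identity (H : C -> C) (rho : R) :
  (0 < rho)%R ->
  (forall z, cut_plane z -> analytic_at H z) ->
  (forall z : C, (Cmod z < rho)%R -> H z = 0) ->
  forall z, cut_plane z -> H z = 0.
Proof.
intros Hrho HA H0 z Hz; destruct (Ceq_dec z 0) as [->|Hz0].
{ apply H0; now rewrite Cmod_0. }
assert (P : (0 < Cmod z)%R) by now apply Cmod_gt_0.
set (E := fun t : R => (0 <= t <= 1)%R /\
  forall s : R, (0 <= s <= t)%R -> H (RtoC s * z) = 0).
destruct (completeness E) as [m [Hub Hlub]].
{ exists 1%R; now intros t [Ht _]. }
{ exists 0%R; split; [lra|]; intros s Hs; replace s with 0%R by lra.
  apply H0; now rewrite Cmult_0_l, Cmod_0. }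
assert (Hm1 : (m <= 1)%R) by (apply Hlub; now intros t [Ht _]).
assert (Hm0 : (0 < m)%R).
{ apply Rlt_le_trans with (Rmin 1 (rho / (2 * Cmod z)))%R.
  - apply Rmin_glb_lt; [lra|apply Rdiv_lt_0_compat; lra].
  - apply Hub; split.
    + split; [|apply Rmin_l].
      apply Rmin_glb; [lra|left; apply Rdiv_lt_0_compat; lra].
    + intros s [Hs1 Hs2]; apply H0.
      rewrite Cmod_mult, Cmod_R, Rabs_pos_eq by exact Hs1.
      assert (Hs3 := Rle_trans _ _ _ Hs2 (Rmin_r _ _)).
      apply Rle_div_r in Hs3; [|lra]; nra. }
assert (Hlt : forall s : R, (0 <= s < m)%R -> H (RtoC s * z) = 0).
{ intros s Hs; destruct (classic (exists t, E t /\ (s < t)%R)) as [[t [[_ Ht] Hst]]|Hno].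
  - apply Ht; lra.
  - exfalso; assert (m <= s)%R; [|lra].
    apply Hlub; intros t Ht; apply Rnot_lt_le; intros Hst; apply Hno; now exists t. }
destruct (HA (RtoC m * z)) as [u [r [Hr Hu]]]; [apply cut_plane_scal; [lra|exact Hz]|].
assert (Hu0 : forall n, u n = 0).
{ apply pseries_C_coef_0; intros eps Heps.
  (* The zero used is the point of parameter [m - d]: still on the segment, closer than [eps] to the
     centre and inside the disk of convergence. *)
  set (d := Rmin m (Rmin eps r / (2 * Cmod z))).
  assert (He : (0 < Rmin eps r)%R) by now apply Rmin_glb_lt.
  assert (Hd : (0 < d)%R) by (apply Rmin_glb_lt; [lra|apply Rdiv_lt_0_compat; lra]).
  assert (Hd1 : (d <= m)%R) by apply Rmin_l.
  assert (Hd2 : (d <= Rmin eps r / (2 * Cmod z))%R) by apply Rmin_r.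
  apply Rle_div_r in Hd2; [|lra].
  assert (Hmod : Cmod (RtoC (- d) * z) = (d * Cmod z)%R).
  { now rewrite Cmod_mult, Cmod_R, Rabs_Ropp, Rabs_pos_eq by lra. }
  assert (He1 := Rmin_l eps r); assert (He2 := Rmin_r eps r).
  exists (RtoC (- d) * z); repeat split.
  - apply Cmult_neq_0; [intros E0; apply RtoC_inj in E0; lra|exact Hz0].
  - rewrite Hmod; lra.
  - replace (RtoC (- d) * z) with (RtoC (m - d) * z - RtoC m * z)
      by (unfold Rminus; rewrite RtoC_plus; ring).
    rewrite <- (Hlt (m - d)%R) by lra; apply Hu.
    replace (RtoC (m - d) * z - RtoC m * z) with (RtoC (- d) * z)
      by (unfold Rminus; rewrite RtoC_plus; ring).
    rewrite Hmod; lra. }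
assert (Hnear : forall s : R, (Rabs (s - m) * Cmod z < r)%R -> H (RtoC s * z) = 0).
{ intros s Hs; apply (is_pseries_C_unique u (RtoC s * z - RtoC m * z)).
  - apply Hu; replace (RtoC s * z - RtoC m * z) with (RtoC (s - m) * z)
      by (unfold Rminus; rewrite RtoC_plus, RtoC_opp; ring).
    now rewrite Cmod_mult, Cmod_R.
  - apply is_pseries_C_iff; apply (is_series_ext (fun n => u n * 0 ^ n)).
    + intros n; now rewrite Hu0, !Cmult_0_l.
    + apply is_pseries_C_iff; assert (Q := is_pseries_C_0 u); now rewrite (Hu0 O) in Q. }
(* A step of [r / (2 * Cmod z)] past [m] stays inside the disk of convergence, so the larger
   parameter belongs to [E]; the cap at 1 then forces [m = 1]. *)
assert (Hle : (Rmin 1 (m + r / (2 * Cmod z)) <= m)%R).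
{ assert (Hq : (0 < r / (2 * Cmod z))%R) by (apply Rdiv_lt_0_compat; lra).
  apply Hub; split; [split; [apply Rmin_glb; lra|apply Rmin_l]|].
  intros s [Hs1 Hs2]; destruct (Rlt_le_dec s m) as [Hsm|Hsm]; [apply Hlt; lra|].
  apply Hnear; rewrite Rabs_pos_eq by lra.
  assert (Hs3 := Rle_trans _ _ _ Hs2 (Rmin_r _ _)).
  assert (Hs4 : (s - m <= r / (2 * Cmod z))%R) by lra.
  apply Rle_div_r in Hs4; [|lra]; nra. }
assert (Hm : m = 1%R).
{ apply Rle_antisym; [exact Hm1|]; revert Hle; apply Rmin_case; [lra|].
  assert (Hq : (0 < r / (2 * Cmod z))%R) by (apply Rdiv_lt_0_compat; lra); lra. }
rewrite <- (Cmult_1_l z); apply Hnear.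
now rewrite Hm, Rminus_diag, Rabs_R0, Rmult_0_l.
Qed.

(** * Contiguity relations *)

Lemma is_pseries_C_null (a : nat -> C) (z l : C) :
  (forall n, a n = 0) -> is_pseries a z l -> l = 0.
Proof.
intros Ha H; apply (is_pseries_C_unique a z); [exact H|].
apply is_pseries_C_iff, (is_series_ext (fun n => a n * 0 ^ n)).
- intros n; now rewrite Ha, !Cmult_0_l.
- apply is_pseries_C_iff; assert (Q := is_pseries_C_0 a); now rewrite (Ha O) in Q.
Qed.

Lemma RtoC_INR_S (n : nat) : RtoC (INR (S n)) = RtoC (INR n) + 1.
Proof. now rewrite S_INR, RtoC_plus. Qed.

Lemma RtoC_INR_S_neq_0 (n : nat) : RtoC (INR n) + 1 <> 0.
Proof. rewrite <- RtoC_INR_S; intros E; apply RtoC_inj in E; now apply (not_0_INR (S n)). Qed.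

Lemma pochhammer_1 (n : nat) : pochhammer 1 n = RtoC (INR (fact n)).
Proof.
induction n as [|n IH]; [reflexivity|].
change (pochhammer 1 n * (1 + RtoC (INR n)) = RtoC (INR (S n * fact n))).
rewrite IH, mult_INR, RtoC_mult, RtoC_INR_S; ring.
Qed.

Lemma pochhammer_pred (b : C) (n : nat) : pochhammer (b - 1) (S n) = (b - 1) * pochhammer b n.
Proof.
induction n as [|n IH]; [simpl; ring|].
change (pochhammer (b - 1) (S n) * (b - 1 + RtoC (INR (S n)))
  = (b - 1) * (pochhammer b n * (b + RtoC (INR n)))).
rewrite IH, RtoC_INR_S; ring.
Qed.

Lemma hyp2F1_coef_S (a b : C) (n : nat) :
  hyp2F1_coef a b 1 (S n)
  = (a + RtoC (INR n)) * (b + RtoC (INR n)) / (RtoC (INR n) + 1) ^ 2 * hyp2F1_coef a b 1 n.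
Proof.
unfold hyp2F1_coef; rewrite !pochhammer_1.
change (fact (S n)) with (S n * fact n)%nat.
change (pochhammer ?x (S n)) with (pochhammer x n * (x + RtoC (INR n))).
rewrite mult_INR, RtoC_mult, RtoC_INR_S.
assert (Hn := RtoC_INR_S_neq_0 n).
assert (Hf : RtoC (INR (fact n)) <> 0)
  by (intros E; apply RtoC_inj in E; now apply (INR_fact_neq_0 n)).
field; auto.
Qed.

Lemma hyp2F1_coef_pred_S (a b : C) (n : nat) :
  hyp2F1_coef a (b - 1) 1 (S n)
  = (b - 1) * (a + RtoC (INR n)) / (RtoC (INR n) + 1) ^ 2 * hyp2F1_coef a b 1 n.
Proof.
unfold hyp2F1_coef; rewrite !pochhammer_1, pochhammer_pred.
change (fact (S n)) with (S n * fact n)%nat.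
change (pochhammer a (S n)) with (pochhammer a n * (a + RtoC (INR n))).
rewrite mult_INR, RtoC_mult, RtoC_INR_S.
assert (Hn := RtoC_INR_S_neq_0 n).
assert (Hf : RtoC (INR (fact n)) <> 0)
  by (intros E; apply RtoC_inj in E; now apply (INR_fact_neq_0 n)).
field; auto.
Qed.

Lemma cut_plane_disk (z : C) : (Cmod z < 1)%R -> cut_plane z.
Proof.
intros Hz [_ H]; assert (H1 := re_le_Cmod z); assert (H2 := Rle_abs (Re z)); lra.
Qed.

Lemma is_hyp2F1_derive (a b c : C) (F : C -> C) :
  is_hyp2F1 a b c F ->
  forall z : C, (Cmod z < 1)%R ->
    is_pseries (fun n => RtoC (INR (S n)) * hyp2F1_coef a b c (S n)) z (C_derive F z).
Proof.
intros [HF HA] z Hz; replace z with (z - 0) at 1 by ring.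
apply (is_pseries_C_derive F 0 (hyp2F1_coef a b c) 1).
- intros z' Hz'; replace (z' - 0) with z' in * by ring; now apply HF.
- intros z' Hz'; replace (z' - 0) with z' in * by ring; now apply HA, cut_plane_disk.
- now replace (z - 0) with z by ring.
Qed.

(** The operator z d/dz + b - 1 multiplies the n-th coefficient by n + b - 1, and (b-1)_n (n + b -
    1) = (b-1) (b)_n, so it sends [G] to (b-1) [F]. *)
Lemma hyp2F1_contiguity_1 (a b : C) (F G : C -> C) :
  is_hyp2F1 a b 1 F -> is_hyp2F1 a (b - 1) 1 G ->
  forall z, cut_plane z -> z * C_derive G z = (b - 1) * (F z - G z).
Proof.
intros HF HG z Hz.
assert (E : z * C_derive G z + ((1 - b) * F z + (b - 1) * G z) = 0);
  [|replace (z * C_derive G z) with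
     (z * C_derive G z + ((1 - b) * F z + (b - 1) * G z) + (b - 1) * (F z - G z)) by ring;
    rewrite E; ring].
revert z Hz; apply (cut_plane_identity _ 1 Rlt_0_1).
- intros z Hz; apply (analytic_at_plus (fun z => z * C_derive G z)).
  + apply analytic_at_mul_id, analytic_at_derive; [apply HG|exact Hz].
  + apply (analytic_at_plus (fun z => (1 - b) * F z)); apply analytic_at_scal;
      [apply HF|apply HG]; exact Hz.
- intros z Hz.
  assert (P := is_pseries_plus _ _ _ _ _
    (is_pseries_incr_1 (K := C_AbsRing) (V := C_NormedModule) _ _ _ (is_hyp2F1_derive _ _ _ _ HG z Hz))
    (is_pseries_plus _ _ _ _ _
      (is_pseries_scal (K := C_AbsRing) (V := C_NormedModule) (1 - b) _ _ _ (Cmult_comm _ _) (proj1 HF z Hz))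
      (is_pseries_scal (K := C_AbsRing) (V := C_NormedModule) (b - 1) _ _ _ (Cmult_comm _ _) (proj1 HG z Hz)))).
  refine (is_pseries_C_null _ _ _ _ P).
  intros [|n].
  + change (0 + ((1 - b) * hyp2F1_coef a b 1 0 + (b - 1) * hyp2F1_coef a (b - 1) 1 0) = 0).
    unfold hyp2F1_coef; simpl; field; intros E; apply RtoC_inj in E; lra.
  + change (RtoC (INR (S n)) * hyp2F1_coef a (b - 1) 1 (S n)
      + ((1 - b) * hyp2F1_coef a b 1 (S n) + (b - 1) * hyp2F1_coef a (b - 1) 1 (S n)) = 0).
    rewrite (hyp2F1_coef_S a b), hyp2F1_coef_pred_S, RtoC_INR_S; field; apply RtoC_INR_S_neq_0.
Qed.

(** In degree n both sides reduce to (a+n) (b-1) / (n+1) times the n-th coefficient of [F], because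
    (b+n) - (n+1) = b - 1. Multiplied by z / F, this is the contiguity relation of the theorem. *)
Lemma hyp2F1_contiguity_2 (a b : C) (F G : C -> C) :
  is_hyp2F1 a b 1 F -> is_hyp2F1 a (b - 1) 1 G ->
  forall z, cut_plane z -> C_derive G z = (1 - z) * C_derive F z - a * F z.
Proof.
intros HF HG z Hz.
assert (E : C_derive G z + (- (1) * C_derive F z + (z * C_derive F z + a * F z)) = 0);
  [|replace (C_derive G z) with
     (C_derive G z + (- (1) * C_derive F z + (z * C_derive F z + a * F z))
      + ((1 - z) * C_derive F z - a * F z)) by ring;
    rewrite E; ring].
revert z Hz; apply (cut_plane_identity _ 1 Rlt_0_1).
- intros z Hz; apply (analytic_at_plus (C_derive G)).
  + apply analytic_at_derive; [apply HG|exact Hz].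
  + apply (analytic_at_plus (fun z => - (1) * C_derive F z)).
    * apply analytic_at_scal, analytic_at_derive; [apply HF|exact Hz].
    * apply (analytic_at_plus (fun z => z * C_derive F z)).
      -- apply analytic_at_mul_id, analytic_at_derive; [apply HF|exact Hz].
      -- now apply analytic_at_scal, HF.
- intros z Hz; assert (PF := is_hyp2F1_derive _ _ _ _ HF z Hz).
  assert (P := is_pseries_plus _ _ _ _ _ (is_hyp2F1_derive _ _ _ _ HG z Hz)
    (is_pseries_plus _ _ _ _ _
      (is_pseries_scal (K := C_AbsRing) (V := C_NormedModule) (- (1)) _ _ _ (Cmult_comm _ _) PF)
      (is_pseries_plus _ _ _ _ _
        (is_pseries_incr_1 (K := C_AbsRing) (V := C_NormedModule) _ _ _ PF)
        (is_pseries_scal (K := C_AbsRing) (V := C_NormedModule) a _ _ _ (Cmult_comm _ _) (proj1 HF z Hz))))).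
  refine (is_pseries_C_null _ _ _ _ P).
  intros [|n].
  + change (RtoC (INR 1) * hyp2F1_coef a (b - 1) 1 1
      + (- (1) * (RtoC (INR 1) * hyp2F1_coef a b 1 1) + (0 + a * hyp2F1_coef a b 1 0)) = 0).
    rewrite (hyp2F1_coef_S a b), hyp2F1_coef_pred_S; simpl; field.
  + change (RtoC (INR (S (S n))) * hyp2F1_coef a (b - 1) 1 (S (S n))
      + (- (1) * (RtoC (INR (S (S n))) * hyp2F1_coef a b 1 (S (S n)))
      + (RtoC (INR (S n)) * hyp2F1_coef a b 1 (S n) + a * hyp2F1_coef a b 1 (S n))) = 0).
    assert (Hn := RtoC_INR_S_neq_0 (S n)).
    rewrite (hyp2F1_coef_S a b (S n)), hyp2F1_coef_pred_S, (RtoC_INR_S (S n)); field; exact Hn.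
Qed.

(** * Laurent coefficients *)

Open Scope R_scope.

(** This is (d)_k / k!, the coefficient of u^k in (1-u)^(-d). For 0 < d < 1 it is positive and
    decreasing, which is the source of the estimates below. *)
Fixpoint binom_coef (d : R) (k : nat) : R :=
  match k with
  | O => 1
  | S j => binom_coef d j * (d + INR j) / (INR j + 1)
  end.

(* The coefficient of [u^n] in the Laurent expansion of [(1 - u)^(-d) (1 - t/u)^(-d)] on [|t| < |u| < 1]. *)
Definition laurent_coef (d : R) (n : nat) (t : R) : R :=
  PSeries (fun k => binom_coef d (n + k) * binom_coef d k) t.

Lemma binom_coef_pos (d : R) (k : nat) : 0 < d -> 0 < binom_coef d k.
Proof.
intros Hd; induction k as [|k IH]; simpl; [lra|].
assert (Hk := pos_INR k).
apply Rdiv_lt_0_compat; [apply Rmult_lt_0_compat|]; lra.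
Qed.

Lemma binom_coef_S_le (d : R) (k : nat) :
  0 < d < 1 -> binom_coef d (S k) <= binom_coef d k.
Proof.
intros Hd; simpl; assert (Hk := pos_INR k); assert (H := binom_coef_pos d k (proj1 Hd)).
apply Rle_div_l; [lra|apply Rmult_le_compat_l; lra].
Qed.

Lemma binom_coef_add_le (d : R) (n k : nat) :
  0 < d < 1 -> binom_coef d (n + k) <= binom_coef d n.
Proof.
intros Hd; induction k as [|k IH]; [rewrite Nat.add_0_r; lra|].
rewrite Nat.add_succ_r; eapply Rle_trans; [now apply binom_coef_S_le|exact IH].
Qed.

Lemma binom_coef_le_1 (d : R) (k : nat) : 0 < d < 1 -> binom_coef d k <= 1.
Proof. intros Hd; exact (binom_coef_add_le d 0 k Hd). Qed.

Lemma binom_coef_prod_le (d : R) (n k : nat) :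
  0 < d < 1 -> 0 < binom_coef d (n + k) * binom_coef d k <= binom_coef d n.
Proof.
intros Hd.
assert (H1 := binom_coef_pos d (n + k) (proj1 Hd)); assert (H2 := binom_coef_pos d k (proj1 Hd)).
assert (H3 := binom_coef_le_1 d k Hd); assert (H4 := binom_coef_add_le d n k Hd).
split; [now apply Rmult_lt_0_compat|]; nra.
Qed.

Lemma CV_radius_bounded_coef (a : nat -> R) (x : R) :
  (forall n, Rabs (a n) <= 1) -> Rabs x < 1 -> Rbar_lt (Rabs x) (CV_radius a).
Proof.
intros Ha Hx; apply Rbar_lt_le_trans with 1; [exact Hx|].
apply (proj1 (CV_radius_bounded a)); exists 1; intros n; now rewrite pow1, Rmult_1_r.
Qed.

Lemma laurent_coef_CV (d : R) (n : nat) (t : R) :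
  0 < d < 1 -> Rabs t < 1 ->
  Rbar_lt (Rabs t) (CV_radius (fun k => binom_coef d (n + k) * binom_coef d k)).
Proof.
intros Hd; apply CV_radius_bounded_coef; intros k.
destruct (binom_coef_prod_le d n k Hd) as [H1 H2]; assert (H3 := binom_coef_le_1 d n Hd).
rewrite Rabs_pos_eq; lra.
Qed.

Lemma is_pseries_laurent_coef (d : R) (n : nat) (t : R) :
  0 < d < 1 -> Rabs t < 1 ->
  is_pseries (fun k => binom_coef d (n + k) * binom_coef d k) t (laurent_coef d n t).
Proof.
intros Hd Ht; now apply PSeries_correct, CV_radius_inside, laurent_coef_CV.
Qed.

(** The factor [binom_coef d n] is kept rather than bounded by 1: for q > 0 it is needed to balance
    the rising factorials of [minimal_sol]. *)
Lemma laurent_coef_bound (d : R) (n : nat) (t : R) :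
  0 < d < 1 -> Rabs t < 1 -> Rabs (laurent_coef d n t) <= binom_coef d n / (1 - Rabs t).
Proof.
intros Hd Ht; unfold laurent_coef, PSeries.
assert (Hg : is_series (fun k => binom_coef d n * Rabs t ^ k) (binom_coef d n * / (1 - Rabs t))).
{ apply (is_series_scal_l (K := R_AbsRing) (V := R_NormedModule)), is_series_geom.
  now rewrite Rabs_Rabsolu. }
assert (Hle : forall k, Rabs (binom_coef d (n + k) * binom_coef d k * t ^ k)
  <= binom_coef d n * Rabs t ^ k).
{ intros k; destruct (binom_coef_prod_le d n k Hd) as [H1 H2].
  rewrite Rabs_mult, <- RPow_abs, (Rabs_pos_eq (_ * _)) by lra.
  apply Rmult_le_compat_r; [apply pow_le, Rabs_pos|exact H2]. }
unfold Rdiv; rewrite <- (is_series_unique _ _ Hg).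
eapply Rle_trans; [apply Series_Rabs|apply Series_le].
- apply (ex_series_le (K := R_AbsRing) (V := R_CompleteNormedModule)) with (2 := ex_intro _ _ Hg).
  intros k; unfold norm; simpl; unfold abs; simpl; rewrite Rabs_Rabsolu; apply Hle.
- intros k; split; [apply Rabs_pos|apply Hle].
- now eexists; apply Hg.
Qed.

Lemma laurent_coef_pos (d : R) (n : nat) (t : R) :
  0 < d < 1 -> 0 <= t < 1 -> 0 < laurent_coef d n t.
Proof.
intros Hd Ht; unfold laurent_coef, PSeries.
assert (Ht' : Rabs t < 1) by (rewrite Rabs_pos_eq; lra).
assert (Hex : ex_series (fun k => binom_coef d (n + k) * binom_coef d k * t ^ k)).
{ eexists; apply is_pseries_R, is_pseries_laurent_coef; auto. }
rewrite Series_incr_1 by exact Hex.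
assert (H0 : 0 < binom_coef d (n + 0) * binom_coef d 0 * t ^ 0).
{ rewrite pow_O, Rmult_1_r; apply binom_coef_prod_le, Hd. }
assert (H1 : 0 <= Series (fun k => binom_coef d (n + S k) * binom_coef d (S k) * t ^ S k)).
{ rewrite <- (Rmult_0_l (Series (fun k => binom_coef d (n + S k) * binom_coef d (S k) * t ^ S k))).
  rewrite <- Series_scal_l; apply Series_le.
  - intros k; assert (Hp := proj1 (binom_coef_prod_le d n (S k) Hd)).
    assert (Hq : 0 <= t ^ S k) by (apply pow_le; lra).
    rewrite Rmult_0_l; split; [lra|apply Rmult_le_pos; lra].
  - now apply (ex_series_incr_1 (fun k => binom_coef d (n + k) * binom_coef d k * t ^ k)) in Hex. }
lra.
Qed.

(** For t < 0 the series alternates with decreasing terms, so its sum is at least that of its first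
    two terms, 1 - d^2 |t| > 0. *)
Lemma laurent_coef_0_pos (d t : R) :
  0 < d < 1 -> Rabs t < 1 -> 0 < laurent_coef d 0 t.
Proof.
intros Hd Ht; destruct (Rle_lt_dec 0 t) as [H0|H0].
{ rewrite Rabs_pos_eq in Ht by exact H0; now apply laurent_coef_pos. }
rewrite Rabs_left in Ht by exact H0.
assert (Hs := is_pseries_laurent_coef d 0 t Hd ltac:(rewrite Rabs_left; lra)).
apply is_pseries_R, is_series_Reals in Hs; simpl in Hs.
set (U := fun k => binom_coef d k * binom_coef d k * (- t) ^ k).
assert (HU : forall k, 0 < binom_coef d k * binom_coef d k <= 1).
{ intros k; exact (binom_coef_prod_le d 0 k Hd). }
assert (HUd : Un_decreasing U).
{ intros k; unfold U.
  assert (H1 := binom_coef_pos d k (proj1 Hd)); assert (H2 := binom_coef_S_le d k Hd).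
  assert (H3 := binom_coef_pos d (S k) (proj1 Hd)).
  assert (H4 : 0 <= (- t) ^ k) by (apply pow_le; lra).
  apply Rmult_le_compat; try (apply Rmult_le_pos; lra).
  - apply pow_le; lra.
  - apply Rmult_le_compat; lra.
  - simpl; rewrite <- (Rmult_1_l ((- t) ^ k)) at 2; apply Rmult_le_compat_r; lra. }
assert (HU0 : Un_cv U 0).
{ apply is_lim_seq_Reals.
  apply is_lim_seq_le_le with (fun _ => 0) (fun k => (- t) ^ k).
  - intros k; unfold U; destruct (HU k) as [H1 H2].
    assert (H4 : 0 <= (- t) ^ k) by (apply pow_le; lra); split; [apply Rmult_le_pos; lra|].
    rewrite <- (Rmult_1_l ((- t) ^ k)) at 2; now apply Rmult_le_compat_r.
  - apply is_lim_seq_const.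
  - apply is_lim_seq_geom; rewrite Rabs_pos_eq; lra. }
assert (Hl : Un_cv (fun N => sum_f_R0 (tg_alt U) N) (laurent_coef d 0 t)).
{ intros eps Heps; destruct (Hs eps Heps) as [N HN]; exists N; intros n Hn.
  erewrite sum_eq; [exact (HN n Hn)|].
  intros k _; unfold tg_alt, U.
  replace (t ^ k) with ((-1) ^ k * (- t) ^ k); [ring|].
  rewrite <- Rpow_mult_distr; f_equal; ring. }
destruct (alternated_series_ineq U _ 0 HUd HU0 Hl) as [H1 _].
simpl in H1; unfold tg_alt, U in H1; simpl in H1.
replace (1 * (d + 0) / (0 + 1)) with d in H1 by field.
assert (d * d < 1) by nra.
assert (d * d * - t < 1) by nra.
lra.
Qed.

Lemma is_pseries_null (a : nat -> R) (x l : R) : (forall n, a n = 0) -> is_pseries a x l -> l = 0.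
Proof.
intros Ha H; rewrite <- (is_pseries_unique _ _ _ H), <- (PSeries_const_0 x).
now apply PSeries_ext.
Qed.

(** The relation comes from the differential equation in u of the generating function, but is
    checked on the coefficients of the powers of [t]. *)
Lemma laurent_coef_recurrence (d : R) (m : nat) (t : R) :
  0 < d < 1 -> Rabs t < 1 ->
  t * (INR m + 2 - d) * laurent_coef d (S (S m)) t
  = (1 + t) * (INR m + 1) * laurent_coef d (S m) t - (INR m + d) * laurent_coef d m t.
Proof.
intros Hd Ht.
assert (P2 := is_pseries_laurent_coef d (S (S m)) t Hd Ht).
assert (P1 := is_pseries_laurent_coef d (S m) t Hd Ht).
assert (P0 := is_pseries_laurent_coef d m t Hd Ht).
assert (C : forall x y : R, mult x y = mult y x) by (intros; apply Rmult_comm).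
assert (P := is_pseries_plus _ _ _ _ _
  (is_pseries_incr_1 (K := R_AbsRing) (V := R_NormedModule) _ _ _
    (is_pseries_plus _ _ _ _ _
      (is_pseries_scal (K := R_AbsRing) (V := R_NormedModule) (INR m + 2 - d) _ _ _ (C _ _) P2)
      (is_pseries_scal (K := R_AbsRing) (V := R_NormedModule) (- (INR m + 1)) _ _ _ (C _ _) P1)))
  (is_pseries_plus _ _ _ _ _
    (is_pseries_scal (K := R_AbsRing) (V := R_NormedModule) (- (INR m + 1)) _ _ _ (C _ _) P1)
    (is_pseries_scal (K := R_AbsRing) (V := R_NormedModule) (INR m + d) _ _ _ (C _ _) P0))).
apply is_pseries_null in P.
- change (t * ((INR m + 2 - d) * laurent_coef d (S (S m)) t + - (INR m + 1) * laurent_coef d (S m) t)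
    + (- (INR m + 1) * laurent_coef d (S m) t + (INR m + d) * laurent_coef d m t) = 0) in P; lra.
- assert (Hm := pos_INR m); intros [|k].
  + change (0 + (- (INR m + 1) * (binom_coef d (S (m + 0)) * 1)
      + (INR m + d) * (binom_coef d (m + 0) * 1)) = 0).
    rewrite Nat.add_0_r; simpl; field; lra.
  + change ((INR m + 2 - d) * (binom_coef d (S (S (m + k))) * binom_coef d k)
      + - (INR m + 1) * (binom_coef d (S (m + k)) * binom_coef d k)
      + (- (INR m + 1) * (binom_coef d (S (m + S k)) * binom_coef d (S k))
      + (INR m + d) * (binom_coef d (m + S k) * binom_coef d (S k))) = 0).
    rewrite Nat.add_succ_r; assert (Hk := pos_INR k).
    change (binom_coef d (S (S (m + k)))) with
      (binom_coef d (S (m + k)) * (d + INR (S (m + k))) / (INR (S (m + k)) + 1)).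
    change (binom_coef d (S k)) with (binom_coef d k * (d + INR k) / (INR k + 1)).
    rewrite S_INR, plus_INR; field; lra.
Qed.

(** With the next lemma, this closes the Laurent coefficients of index 0 and 1 into a first order
    linear system in [t]; both are comparisons of coefficients after clearing denominators. *)
Lemma is_derive_laurent_coef_0 (d t : R) :
  0 < d < 1 -> Rabs t < 1 ->
  is_derive (laurent_coef d 0) t ((d * laurent_coef d 0 t - (1 - d) * laurent_coef d 1 t) / (1 - t)).
Proof.
intros Hd Ht; assert (CV := laurent_coef_CV d 0 t Hd Ht).
assert (HD := is_derive_PSeries _ _ CV).
set (a := fun k => binom_coef d (0 + k) * binom_coef d k) in *.
assert (PD : is_pseries (PS_derive a) t (PSeries (PS_derive a) t)).
{ apply PSeries_correct, CV_radius_inside; now rewrite CV_radius_derive. }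
set (D := PSeries (PS_derive a) t) in *.
replace (_ / _) with D; [exact HD|].
assert (P0 := is_pseries_laurent_coef d 0 t Hd Ht).
assert (P1 := is_pseries_laurent_coef d 1 t Hd Ht).
assert (C : forall x y : R, mult x y = mult y x) by (intros; apply Rmult_comm).
assert (P := is_pseries_plus _ _ _ _ _ PD
  (is_pseries_plus _ _ _ _ _
    (is_pseries_incr_1 (K := R_AbsRing) (V := R_NormedModule) _ _ _
      (is_pseries_scal (K := R_AbsRing) (V := R_NormedModule) (-1) _ _ _ (C _ _) PD))
    (is_pseries_plus _ _ _ _ _
      (is_pseries_scal (K := R_AbsRing) (V := R_NormedModule) (- d) _ _ _ (C _ _) P0)
      (is_pseries_scal (K := R_AbsRing) (V := R_NormedModule) (1 - d) _ _ _ (C _ _) P1)))).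
apply is_pseries_null in P.
- change (D + (t * (-1 * D) + (- d * laurent_coef d 0 t + (1 - d) * laurent_coef d 1 t)) = 0) in P.
  assert (t < 1) by (apply Rabs_def2 in Ht; lra).
  apply (Rmult_eq_reg_r (1 - t)); [|lra]; unfold Rdiv; rewrite Rmult_assoc, Rinv_l; lra.
- intros [|k].
  + change (1 * (binom_coef d 1 * binom_coef d 1) + (0 + (- d * (1 * 1)
      + (1 - d) * (binom_coef d 1 * 1))) = 0); simpl; field.
  + change (INR (S (S k)) * (binom_coef d (S (S k)) * binom_coef d (S (S k)))
      + (-1 * (INR (S k) * (binom_coef d (S k) * binom_coef d (S k)))
      + (- d * (binom_coef d (S k) * binom_coef d (S k))
      + (1 - d) * (binom_coef d (S (S k)) * binom_coef d (S k)))) = 0).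
    change (binom_coef d (S (S k))) with
      (binom_coef d (S k) * (d + INR (S k)) / (INR (S k) + 1)).
    rewrite (S_INR (S k)); assert (Hk := pos_INR (S k)); field; lra.
Qed.

Lemma is_derive_laurent_coef_1 (d t : R) :
  0 < d < 1 -> Rabs t < 1 -> t <> 0 ->
  is_derive (laurent_coef d 1) t
    ((d * laurent_coef d 0 t - (1 - d * t) * laurent_coef d 1 t) / (t * (1 - t))).
Proof.
intros Hd Ht Ht0; assert (CV := laurent_coef_CV d 1 t Hd Ht).
assert (HD := is_derive_PSeries _ _ CV).
set (a := fun k => binom_coef d (1 + k) * binom_coef d k) in *.
assert (PD : is_pseries (PS_derive a) t (PSeries (PS_derive a) t)).
{ apply PSeries_correct, CV_radius_inside; now rewrite CV_radius_derive. }
set (D := PSeries (PS_derive a) t) in *.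
replace (_ / _) with D; [exact HD|].
assert (P0 := is_pseries_laurent_coef d 0 t Hd Ht).
assert (P1 := is_pseries_laurent_coef d 1 t Hd Ht).
assert (C : forall x y : R, mult x y = mult y x) by (intros; apply Rmult_comm).
assert (P := is_pseries_plus _ _ _ _ _
  (is_pseries_incr_1 (K := R_AbsRing) (V := R_NormedModule) _ _ _
    (is_pseries_plus _ _ _ _ _ PD
      (is_pseries_plus _ _ _ _ _
        (is_pseries_incr_1 (K := R_AbsRing) (V := R_NormedModule) _ _ _
          (is_pseries_scal (K := R_AbsRing) (V := R_NormedModule) (-1) _ _ _ (C _ _) PD))
        (is_pseries_scal (K := R_AbsRing) (V := R_NormedModule) (- d) _ _ _ (C _ _) P1))))
  (is_pseries_plus _ _ _ _ _
    (is_pseries_scal (K := R_AbsRing) (V := R_NormedModule) (- d) _ _ _ (C _ _) P0) P1)).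
apply is_pseries_null in P.
- change (t * (D + (t * (-1 * D) + - d * laurent_coef d 1 t))
    + (- d * laurent_coef d 0 t + laurent_coef d 1 t) = 0) in P.
  assert (t < 1) by (apply Rabs_def2 in Ht; lra).
  assert (Hp : t * (1 - t) <> 0) by (apply Rmult_integral_contrapositive; lra).
  apply (Rmult_eq_reg_r (t * (1 - t))); [|exact Hp].
  unfold Rdiv; rewrite (Rmult_assoc (_ - _)), Rinv_l; [lra|exact Hp].
- intros [|[|k]].
  + change (0 + (- d * (1 * 1) + binom_coef d 1 * 1) = 0); simpl; field.
  + change (1 * (binom_coef d 2 * binom_coef d 1) + (0 + - d * (binom_coef d 1 * 1))
      + (- d * (binom_coef d 1 * binom_coef d 1) + binom_coef d 2 * binom_coef d 1) = 0).
    simpl; field.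
  + change (INR (S (S k)) * (binom_coef d (S (S (S k))) * binom_coef d (S (S k)))
      + (-1 * (INR (S k) * (binom_coef d (S (S k)) * binom_coef d (S k)))
        + - d * (binom_coef d (S (S k)) * binom_coef d (S k)))
      + (- d * (binom_coef d (S (S k)) * binom_coef d (S (S k)))
        + binom_coef d (S (S (S k))) * binom_coef d (S (S k))) = 0).
    change (binom_coef d (S (S (S k)))) with
      (binom_coef d (S (S k)) * (d + INR (S (S k))) / (INR (S (S k)) + 1)).
    change (binom_coef d (S (S k))) with
      (binom_coef d (S k) * (d + INR (S k)) / (INR (S k) + 1)).
    rewrite (S_INR (S k)); assert (Hk := pos_INR (S k)); field; lra.
Qed.

(** * The linear system in the quadratic variable *)

(** The mean value theorem between 0 and [t] asks for the derivative only in the open interval, so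
    the singular point 0 of the systems below costs no more than continuity there. *)
Lemma eq_at_0_of_derive_0 (g : R -> R) (t : R) :
  (forall s, -1 < s < 1 -> continuity_pt g s) ->
  (forall s, -1 < s < 1 -> s <> 0 -> is_derive g s 0) ->
  -1 < t < 1 -> g t = g 0.
Proof.
intros Hc Hd Ht; destruct (MVT_gen g 0 t (fun _ => 0)) as [c [_ Hg]].
- intros s Hs; apply Hd; revert Hs; unfold Rmin, Rmax; destruct (Rle_dec 0 t); lra.
- intros s Hs; apply Hc; revert Hs; unfold Rmin, Rmax; destruct (Rle_dec 0 t); lra.
- lra.
Qed.

Lemma continuity_pt_laurent_coef (d : R) (n : nat) (t : R) :
  0 < d < 1 -> -1 < t < 1 -> continuity_pt (laurent_coef d n) t.
Proof.
intros Hd Ht; apply PSeries_continuity, laurent_coef_CV; [exact Hd|apply Rabs_def1; lra].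
Qed.

Lemma continuity_pt_exp_ln (a b t : R) : -1 < t < 1 ->
  continuity_pt (fun s => exp (a * ln (1 + s) + b * ln (1 - s))) t.
Proof.
intros Ht; apply derivable_continuous_pt, ex_derive_Reals_0.
auto_derive; lra.
Qed.

(* The two solutions [(f, u)] and [(laurent_coef d 0, - (1 - d) t / (1 + t) laurent_coef d 1)]
   (the latter up to the factor [(1 + t)^d]) have a Wronskian that solves a first order
   linear equation and vanishes at [0], so they are proportional. *)
Lemma legendre_system_unique (d : R) (f u : R -> R) :
  0 < d < 1 ->
  (forall t, -1 < t < 1 -> continuity_pt f t) ->
  (forall t, -1 < t < 1 -> continuity_pt u t) ->
  (forall t, -1 < t < 1 -> t <> 0 ->
     is_derive f t (2 * d / ((1 + t) * (1 - t)) * f t + (1 + t) / (t * (1 - t)) * u t)) ->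
  (forall t, -1 < t < 1 -> t <> 0 ->
     is_derive u t (- 2 * (1 - d) / ((1 + t) * (1 - t)) * (d / 2 * f t + u t))) ->
  u 0 = 0 ->
  forall t, -1 < t < 1 ->
    u t * laurent_coef d 0 t = - (1 - d) * t / (1 + t) * laurent_coef d 1 t * f t /\
    f t = f 0 * exp (d * ln (1 + t)) * laurent_coef d 0 t.
Proof.
intros Hd cf cu df du u0.
assert (Ha : forall t, -1 < t < 1 -> Rabs t < 1) by (intros; apply Rabs_def1; lra).
assert (Spos : forall t, -1 < t < 1 -> 0 < laurent_coef d 0 t)
  by (intros; apply laurent_coef_0_pos; auto).
assert (HV : forall t, -1 < t < 1 ->
  u t * laurent_coef d 0 t = - (1 - d) * t / (1 + t) * laurent_coef d 1 t * f t).
{ intros t Ht.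
  (* The exponential is the integrating factor (1+s)^(1-d) (1-s)^(2d-1) of the equation of the
     Wronskian, which makes [V] constant; [V 0 = 0] since both s / (1+s) and [u] vanish at 0. *)
  set (V := fun s => (- (1 - d) * (s / (1 + s)) * laurent_coef d 1 s * f s - u s * laurent_coef d 0 s)
    * exp ((1 - d) * ln (1 + s) + (2 * d - 1) * ln (1 - s))).
  assert (E : V t = V 0).
  { apply eq_at_0_of_derive_0; [| |exact Ht]; unfold V.
    - intros s Hs; apply (continuity_pt_mult _ (fun s => exp _)); [|now apply continuity_pt_exp_ln].
      apply (continuity_pt_minus (fun s => _ * f s)).
      + apply continuity_pt_mult; [|now apply cf].
        apply continuity_pt_mult; [|now apply continuity_pt_laurent_coef].
        apply derivable_continuous_pt, ex_derive_Reals_0; auto_derive; lra.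
      + apply continuity_pt_mult; [now apply cu|now apply continuity_pt_laurent_coef].
    - intros s Hs Hs0.
      assert (Df := df s Hs Hs0); assert (Du := du s Hs Hs0).
      assert (D0 := is_derive_laurent_coef_0 d s Hd (Ha s Hs)).
      assert (D1 := is_derive_laurent_coef_1 d s Hd (Ha s Hs) Hs0).
      auto_derive.
      + repeat split; try (eexists; eassumption); lra.
      + rewrite (is_derive_unique (fun x : R => f x) _ _ Df), (is_derive_unique (fun x : R => u x) _ _ Du),
          (is_derive_unique (fun x : R => laurent_coef d 0 x) _ _ D0),
          (is_derive_unique (fun x : R => laurent_coef d 1 x) _ _ D1).
        field; lra. }
  unfold V in E; rewrite u0 in E; unfold Rdiv in E at 2.
  rewrite !Rmult_0_l, !Rmult_0_r, !Rmult_0_l, Rminus_0_r, !Rmult_0_l in E.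
  apply Rmult_integral in E; destruct E as [E|E].
  - unfold Rdiv in *; lra.
  - exfalso; assert (H := exp_pos ((1 - d) * ln (1 + t) + (2 * d - 1) * ln (1 - t))); lra. }
intros t Ht; split; [now apply HV|].
(* Once [HV] eliminates [u], the quotient of [f] by [laurent_coef d 0] has logarithmic derivative d
   / (1+s). The null term gives the exponent the shape required by [continuity_pt_exp_ln]. *)
set (k := fun s => f s / laurent_coef d 0 s * exp (- d * ln (1 + s) + 0 * ln (1 - s))).
assert (E : k t = k 0).
{ apply eq_at_0_of_derive_0; [| |exact Ht]; unfold k.
  - intros s Hs; apply (continuity_pt_mult _ (fun s => exp _)); [|now apply continuity_pt_exp_ln].
    apply continuity_pt_div; [now apply cf|now apply continuity_pt_laurent_coef|].
    apply Rgt_not_eq, Spos, Hs.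
  - intros s Hs Hs0; assert (P := Spos s Hs).
    assert (Df := df s Hs Hs0).
    assert (D0 := is_derive_laurent_coef_0 d s Hd (Ha s Hs)).
    auto_derive.
    + repeat split; try (eexists; eassumption); lra.
    + rewrite (is_derive_unique (fun x : R => f x) _ _ Df),
        (is_derive_unique (fun x : R => laurent_coef d 0 x) _ _ D0).
      replace (u s) with (- (1 - d) * s / (1 + s) * laurent_coef d 1 s * f s / laurent_coef d 0 s)
        by (rewrite <- (HV s Hs); field; lra).
      field; repeat split; lra. }
unfold k in E.
assert (P := Spos t Ht).
assert (E0 : laurent_coef d 0 0 = 1).
{ unfold laurent_coef; rewrite PSeries_0; simpl; ring. }
rewrite E0, Rplus_0_r, Rminus_0_r, ln_1 in E.
replace (- d * 0 + 0 * 0) with 0 in E by ring.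
replace (- d * ln (1 + t) + 0 * ln (1 - t)) with (- (d * ln (1 + t))) in E by ring.
rewrite exp_0, exp_Ropp in E.
assert (Pe := exp_pos (d * ln (1 + t))).
replace (f 0) with (f 0 / 1 * 1) by field.
rewrite <- E; field; lra.
Qed.

(** * The minimal solution of the recurrence *)

Fixpoint rising (x : R) (n : nat) : R :=
  match n with
  | O => 1
  | S k => rising x k * (x + INR k)
  end.

(* The recurrence of the convergents, written with the roots [p], [q] of [t^2 - A t + K D^2] and with [d = 1 / D]. *)
Definition solves (p q d : R) (y : nat -> R) : Prop :=
  forall k, y (S (S k)) = (p + q) * (INR k + 1) * y (S k)
    - p * q * ((INR k + 1 - d) * (INR k + d)) * y k.

Definition minimal_sol (p q d : R) (n : nat) : R :=
  q ^ n * rising (1 - d) n * laurent_coef d n (q / p).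

Lemma rising_pos (x : R) (n : nat) : 0 < x -> 0 < rising x n.
Proof.
intros Hx; induction n as [|n IH]; simpl; [lra|].
assert (Hn := pos_INR n); apply Rmult_lt_0_compat; lra.
Qed.

Lemma rising_binom_coef (d : R) (n : nat) : rising d n = binom_coef d n * INR (fact n).
Proof.
induction n as [|n IH]; [simpl; ring|].
change (fact (S n)) with (S n * fact n)%nat; rewrite mult_INR, S_INR; simpl.
rewrite IH; field; assert (Hn := pos_INR n); lra.
Qed.

(* Off by one, the factors pair up as [(k - d) (k + d) <= k ^ 2]. *)
Lemma rising_prod_le (d : R) (n : nat) :
  0 < d < 1 ->
  rising (1 - d) (S n) * rising d (S n) <= INR (fact n) * INR (fact (S n)).
Proof.
intros Hd.
assert (Hf : 0 < INR (fact n)) by apply INR_fact_lt_0.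
assert (Hn := pos_INR n).
(* The pairing leaves out the first factor [d], at most 1, and the last factor n + 1 - d, which the
   induction has to carry. *)
apply Rle_trans with (INR (fact n) ^ 2 * (INR n + 1 - d)).
- clear Hf Hn; induction n as [|n IH]; [simpl; nra|].
  change (rising (1 - d) (S (S n))) with (rising (1 - d) (S n) * (1 - d + INR (S n))).
  change (rising d (S (S n))) with (rising d (S n) * (d + INR (S n))).
  change (fact (S n)) with (S n * fact n)%nat; rewrite mult_INR, S_INR.
  assert (Hn := pos_INR n).
  assert (Hf : 0 < INR (fact n) ^ 2) by apply pow_lt, INR_fact_lt_0.
  apply Rle_trans with (INR (fact n) ^ 2 * (INR n + 1 - d) * ((INR n + 2 - d) * (INR n + 1 + d))).
  + replace (rising (1 - d) (S n) * (1 - d + (INR n + 1)) * (rising d (S n) * (d + (INR n + 1))))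
      with (rising (1 - d) (S n) * rising d (S n) * ((INR n + 2 - d) * (INR n + 1 + d))) by ring.
    apply Rmult_le_compat_r; [apply Rmult_le_pos; lra|exact IH].
  + replace (INR (fact n) ^ 2 * (INR n + 1 - d) * ((INR n + 2 - d) * (INR n + 1 + d)))
      with (INR (fact n) ^ 2 * (INR n + 2 - d) * ((INR n + 1) ^ 2 - d ^ 2)) by ring.
    replace (((INR n + 1) * INR (fact n)) ^ 2 * (INR n + 1 + 1 - d))
      with (INR (fact n) ^ 2 * (INR n + 2 - d) * (INR n + 1) ^ 2) by ring.
    apply Rmult_le_compat_l; [apply Rmult_le_pos; lra|nra].
- change (fact (S n)) with (S n * fact n)%nat; rewrite mult_INR, S_INR; nra.
Qed.

(** This is [laurent_coef_recurrence] at t = q/p times p q^(k+1) (1-d)_(k+1): the factor k + 2 - d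
    completes the rising factorial, and p (1+t) = p + q. *)
Lemma minimal_sol_solves (p q d : R) :
  0 < d < 1 -> Rabs q < p -> solves p q d (minimal_sol p q d).
Proof.
intros Hd Hq k.
assert (Hp : 0 < p) by (assert (H := Rabs_pos q); lra).
assert (Ht : Rabs (q / p) < 1).
{ unfold Rdiv; rewrite Rabs_mult, Rabs_inv, (Rabs_pos_eq p) by lra.
  apply Rlt_div_l; lra. }
assert (H := laurent_coef_recurrence d k (q / p) Hd Ht).
unfold minimal_sol.
change (rising (1 - d) (S (S k))) with (rising (1 - d) k * (1 - d + INR k) * (1 - d + INR (S k))).
change (rising (1 - d) (S k)) with (rising (1 - d) k * (1 - d + INR k)).
change (q ^ S (S k)) with (q * (q * q ^ k)); change (q ^ S k) with (q * q ^ k).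
rewrite S_INR.
transitivity (p * q * q ^ k * rising (1 - d) k * (1 - d + INR k)
  * (q / p * (INR k + 2 - d) * laurent_coef d (S (S k)) (q / p))); [field; lra|].
rewrite H; field; lra.
Qed.

Lemma solves_lincomb (p q d : R) (y w m : nat -> R) :
  solves p q d y -> y O = 0 -> y 1%nat = 1 ->
  solves p q d w -> w O = 1 -> w 1%nat = 0 ->
  solves p q d m -> forall n, m n = m O * w n + m 1%nat * y n.
Proof.
intros Hy y0 y1 Hw w0 w1 Hm n.
enough (H : m n = m O * w n + m 1%nat * y n /\ m (S n) = m O * w (S n) + m 1%nat * y (S n))
  by apply H.
induction n as [|n [IH1 IH2]]; [rewrite y0, y1, w0, w1; split; ring|].
split; [exact IH2|]; rewrite Hy, Hw, Hm, IH1, IH2; ring.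
Qed.

Lemma casoratian (p q d : R) (y m : nat -> R) :
  solves p q d y -> y O = 0 -> y 1%nat = 1 -> solves p q d m ->
  forall n, y (S n) * m n - y n * m (S n) = m O * (p * q) ^ n * (rising (1 - d) n * rising d n).
Proof.
intros Hy y0 y1 Hm n; induction n as [|n IH]; [rewrite y0, y1; simpl; ring|].
rewrite Hy, Hm; simpl.
transitivity (p * q * ((INR n + 1 - d) * (INR n + d)) * (y (S n) * m n - y n * m (S n))); [ring|].
rewrite IH; ring.
Qed.

(** Up to a factor [x] and a shift, these are the terms of the differentiated geometric series,
    which converges. *)
Lemma is_lim_seq_INR_mult_geom (x : R) : Rabs x < 1 -> is_lim_seq (fun n => INR n * x ^ n) 0.
Proof.
intros Hx; apply is_lim_seq_incr_1.
assert (CV : Rbar_lt (Rabs x) (CV_radius (fun _ => 1))).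
{ apply CV_radius_bounded_coef; [intros n; rewrite Rabs_R1; lra|exact Hx]. }
assert (H := is_pseries_derive _ _ CV); apply is_pseries_R in H.
assert (L := ex_series_lim_0 _ (ex_intro _ _ H)).
apply (is_lim_seq_scal_l _ x) in L; simpl in L; rewrite Rmult_0_r in L.
eapply is_lim_seq_ext; [|exact L]; intros n; cbv beta; unfold PS_derive.
change (x ^ S n) with (x * x ^ n); ring.
Qed.

(** By the Casoratian, y/m increases at step n by m(0) (pq)^n (1-d)_n (d)_n / (m(n) m(n+1)). The
    bounds on [laurent_coef] keep this increment above a constant [c] > 0, so y/m grows at least
    linearly. *)
Lemma minimal_sol_div_pos (p q d : R) (y : nat -> R) :
  0 < d < 1 -> 0 < q < p -> solves p q d y -> y O = 0 -> y 1%nat = 1 ->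
  (forall n, (1 <= n)%nat -> 0 < y n) /\ is_lim_seq (fun n => minimal_sol p q d n / y n) 0.
Proof.
intros Hd Hq Hy y0 y1.
set (m := minimal_sol p q d).
assert (Ht : 0 < q / p < 1).
{ split; [apply Rdiv_lt_0_compat; lra|apply Rlt_div_l; lra]. }
assert (Hm : solves p q d m) by (apply minimal_sol_solves; [exact Hd|rewrite Rabs_pos_eq; lra]).
assert (Spos : forall n, 0 < laurent_coef d n (q / p)).
{ intros n; apply laurent_coef_pos; lra. }
assert (mpos : forall n, 0 < m n).
{ intros n; unfold m, minimal_sol; apply Rmult_lt_0_compat; [|apply Spos].
  apply Rmult_lt_0_compat; [apply pow_lt|apply rising_pos]; lra. }
set (B := / (1 - q / p)).
assert (HB : 0 < B) by (apply Rinv_0_lt_compat; lra).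
assert (HS : forall n, laurent_coef d n (q / p) <= binom_coef d n * B).
{ intros n; assert (H := laurent_coef_bound d n (q / p) Hd).
  rewrite !Rabs_pos_eq in H by (try apply Rlt_le, Spos; lra); apply H; lra. }
set (c := m O / (q * B ^ 2)).
assert (HqB : 0 < q * B ^ 2) by (apply Rmult_lt_0_compat; [lra|now apply pow_lt]).
assert (Hc : 0 < c) by (apply Rdiv_lt_0_compat; [apply mpos|exact HqB]).
assert (Hmm : forall n, m n * m (S n) <= q * B ^ 2 * (q ^ (2 * n) * (rising (1 - d) n * rising d n))).
{ intros n.
  assert (Hr := rising_pos (1 - d) n ltac:(lra)); assert (Hr' := rising_pos (1 - d) (S n) ltac:(lra)).
  assert (Hqn : 0 < q ^ n) by (apply pow_lt; lra).
  assert (Hb := binom_coef_pos d n (proj1 Hd)); assert (Hb' := binom_coef_pos d (S n) (proj1 Hd)).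
  assert (HSn := Spos n); assert (HSn' := Spos (S n)).
  assert (Hf : 0 < INR (fact n)) by apply INR_fact_lt_0.
  assert (Hf' : 0 < INR (fact (S n))) by apply INR_fact_lt_0.
  assert (HSS : laurent_coef d n (q / p) * laurent_coef d (S n) (q / p)
    <= binom_coef d n * B * (binom_coef d (S n) * B)).
  { apply Rmult_le_compat; try lra; apply HS. }
  (* Writing (d)_k as k! times [binom_coef d k] turns this into [rising_prod_le]. *)
  assert (Hrb : rising (1 - d) (S n) * (binom_coef d n * binom_coef d (S n)) <= rising d n).
  { assert (Hp := rising_prod_le d n Hd).
    rewrite (rising_binom_coef d (S n)) in Hp; rewrite (rising_binom_coef d n).
    apply (Rmult_le_reg_r (INR (fact (S n)))); [exact Hf'|].
    replace (binom_coef d n * INR (fact n) * INR (fact (S n)))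
      with (binom_coef d n * (INR (fact n) * INR (fact (S n)))) by ring.
    eapply Rle_trans; [|apply Rmult_le_compat_l; [left; exact Hb|exact Hp]].
    right; ring. }
  replace (q ^ (2 * n)) with (q ^ n * q ^ n) by (rewrite <- pow_add; f_equal; lia).
  unfold m, minimal_sol; change (q ^ S n) with (q * q ^ n).
  apply Rle_trans with (q ^ n * q ^ n * q * rising (1 - d) n * rising (1 - d) (S n)
    * (binom_coef d n * B * (binom_coef d (S n) * B))).
  - eapply Rle_trans; [|apply Rmult_le_compat_l; [|exact HSS]]; [right; ring|].
    clear - Hqn Hq Hr Hr'; repeat (apply Rmult_le_pos; [|lra]); lra.
  - replace (q * B ^ 2 * (q ^ n * q ^ n * (rising (1 - d) n * rising d n)))
      with (q ^ n * q ^ n * q * rising (1 - d) n * B ^ 2 * rising d n) by ring.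
    eapply Rle_trans; [|apply Rmult_le_compat_l; [|exact Hrb]]; [right; ring|].
    assert (HB2 : 0 < B ^ 2) by now apply pow_lt.
    repeat (apply Rmult_le_pos; [|lra]); lra. }
assert (Hinc : forall n, y n / m n + c <= y (S n) / m (S n)).
{ intros n; assert (Hcas := casoratian p q d y m Hy y0 y1 Hm n).
  assert (H1 := mpos n); assert (H2 := mpos (S n)).
  apply (Rmult_le_reg_r (m n * m (S n))); [now apply Rmult_lt_0_compat|].
  replace (y (S n) / m (S n) * (m n * m (S n)))
    with (y n * m (S n) + m O * (p * q) ^ n * (rising (1 - d) n * rising d n))
    by (rewrite <- Hcas; field; lra).
  replace ((y n / m n + c) * (m n * m (S n))) with (y n * m (S n) + c * (m n * m (S n)))
    by (field; lra).
  apply Rplus_le_compat_l.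
  eapply Rle_trans; [apply Rmult_le_compat_l; [left; exact Hc|apply Hmm]|].
  unfold c; replace (m O / (q * B ^ 2) * (q * B ^ 2 * (q ^ (2 * n) * (rising (1 - d) n * rising d n))))
    with (m O * q ^ (2 * n) * (rising (1 - d) n * rising d n)) by (field; split; lra).
  apply Rmult_le_compat_r.
  - apply Rmult_le_pos; left; apply rising_pos; lra.
  - apply Rmult_le_compat_l; [left; apply mpos|].
    rewrite pow_mult; apply pow_incr; nra. }
assert (Hh : forall n, c * INR n <= y n / m n).
{ induction n as [|n IH]; [rewrite y0; simpl; unfold Rdiv; lra|].
  rewrite S_INR; specialize (Hinc n); lra. }
assert (ypos : forall n, (1 <= n)%nat -> 0 < y n).
{ intros n Hn; assert (H1 := Hh n); assert (H2 := mpos n).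
  apply le_INR in Hn; simpl in Hn.
  replace (y n) with (y n / m n * m n) by (field; lra).
  apply Rmult_lt_0_compat; nra. }
split; [exact ypos|].
(* The shift avoids index 0, where [y] vanishes. *)
apply is_lim_seq_incr_1, (is_lim_seq_le_le (fun _ => 0) _ (fun n => / c * / INR (S n))).
- intros n; assert (H1 := Hh (S n)); assert (H2 := mpos (S n)); assert (H3 := ypos (S n) ltac:(lia)).
  assert (H4 : 0 < INR (S n)) by apply lt_0_INR, Nat.lt_0_succ.
  split; [left; now apply Rdiv_lt_0_compat|].
  rewrite <- Rinv_mult.
  replace (m (S n) / y (S n)) with (/ (y (S n) / m (S n))) by (field; lra).
  apply Rinv_le_contravar; [now apply Rmult_lt_0_compat|exact H1].
- apply is_lim_seq_const.
- replace 0 with (/ c * 0) by ring.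
  apply is_lim_seq_scal_l with (lu := Finite 0).
  apply (is_lim_seq_inv (fun n => INR (S n)) p_infty); [|discriminate].
  apply -> (is_lim_seq_incr_1 INR); apply is_lim_seq_INR.
Qed.

(** Here p + q and - p q are positive, so the recurrence preserves inequalities: a subsolution lying
    below [y] at two consecutive indices stays below it. One of growth p^n (1-d)_n / n suffices, as
    [minimal_sol] is at most of order |q|^n (1-d)_n. *)
Lemma minimal_sol_div_neg (p q d : R) (y : nat -> R) :
  0 < d < 1 -> q < 0 -> - q < p -> solves p q d y -> y O = 0 -> y 1%nat = 1 ->
  (forall n, (1 <= n)%nat -> 0 < y n) /\ is_lim_seq (fun n => minimal_sol p q d n / y n) 0.
Proof.
intros Hd Hq Hqp Hy y0 y1.
assert (Ht : Rabs (q / p) < 1).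
{ unfold Rdiv; rewrite Rabs_mult, Rabs_inv, (Rabs_left q), (Rabs_pos_eq p) by lra.
  apply Rlt_div_l; lra. }
assert (rpos : forall n, 0 < rising (1 - d) n) by (intros; apply rising_pos; lra).
(* The sequence p^n (1-d)_n / n, shifted by one. After removal of the common factor [X], the
   subsolution inequality reads p (N+3-d) / (N+3) <= p - q d / (N+1), with [p] in between. *)
set (z := fun n => p ^ S n * rising (1 - d) (S n) / (INR n + 1)).
assert (zpos : forall n, 0 < z n).
{ intros n; assert (Hn := pos_INR n); apply Rdiv_lt_0_compat; [|lra].
  apply Rmult_lt_0_compat; [apply pow_lt; lra|apply rpos]. }
(* Chosen to fit the two starting values y(1) = 1 and y(2) = p + q. *)
set (c := Rmin (/ z O) ((p + q) / z 1%nat)).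
assert (Hc : 0 < c).
{ apply Rmin_glb_lt; [apply Rinv_0_lt_compat, zpos|apply Rdiv_lt_0_compat; [lra|apply zpos]]. }
assert (Hsub : forall n, z (S (S n)) <= (p + q) * (INR (S n) + 1) * z (S n)
    - p * q * ((INR (S n) + 1 - d) * (INR (S n) + d)) * z n).
{ intros n; unfold z.
  change (rising (1 - d) (S (S (S n)))) with (rising (1 - d) (S n) * (1 - d + INR (S n)) * (1 - d + INR (S (S n)))).
  change (rising (1 - d) (S (S n))) with (rising (1 - d) (S n) * (1 - d + INR (S n))).
  change (p ^ S (S (S n))) with (p * (p * p ^ S n)); change (p ^ S (S n)) with (p * p ^ S n).
  rewrite !S_INR; set (N := INR n); assert (HN : 0 <= N) by apply pos_INR.
  assert (Hpn : 0 < p ^ S n) by (apply pow_lt; lra).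
  assert (Hr := rpos (S n)).
  set (X := p * p ^ S n * rising (1 - d) (S n) * (N + 2 - d)).
  assert (HX : 0 < X) by (unfold X; repeat (apply Rmult_lt_0_compat; [|lra]); lra).
  replace (p * (p * p ^ S n) * (rising (1 - d) (S n) * (1 - d + (N + 1)) * (1 - d + (N + 1 + 1)))
    / (N + 1 + 1 + 1)) with (X * (p * ((N + 3 - d) / (N + 3)))) by (unfold X; field; lra).
  replace ((p + q) * (N + 1 + 1) * (p * p ^ S n * (rising (1 - d) (S n) * (1 - d + (N + 1))) / (N + 1 + 1))
    - p * q * ((N + 1 + 1 - d) * (N + 1 + d)) * (p ^ S n * rising (1 - d) (S n) / (N + 1)))
    with (X * ((p + q) - q * ((N + 1 + d) / (N + 1)))) by (unfold X; field; lra).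
  apply Rmult_le_compat_l; [lra|].
  assert (H1 : (N + 3 - d) / (N + 3) <= 1) by (apply Rle_div_l; lra).
  assert (H2 : 1 <= (N + 1 + d) / (N + 1)) by (apply Rle_div_r; lra).
  nra. }
assert (Hlow : forall n, c * z n <= y (S n)).
{ intros n; enough (H : c * z n <= y (S n) /\ c * z (S n) <= y (S (S n))) by apply H.
  induction n as [|n [IH1 IH2]].
  - assert (H0 := zpos O); assert (H1 := zpos 1%nat); split.
    + rewrite y1; apply Rle_div_r; [exact H0|]; unfold Rdiv; rewrite Rmult_1_l; apply Rmin_l.
    + rewrite Hy, y0, y1, Rmult_0_r; simpl (INR 0).
      replace ((p + q) * (0 + 1) * 1 - 0) with (p + q) by ring.
      apply Rle_div_r; [exact H1|apply Rmin_r].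
  - split; [exact IH2|].
    rewrite (Hy (S n)).
    eapply Rle_trans; [apply Rmult_le_compat_l; [left; exact Hc|apply Hsub]|].
    assert (Hn := pos_INR (S n)).
    assert (H1 : 0 <= (p + q) * (INR (S n) + 1)) by (apply Rmult_le_pos; lra).
    assert (H2 : 0 <= - (p * q) * ((INR (S n) + 1 - d) * (INR (S n) + d))).
    { apply Rmult_le_pos; [nra|apply Rmult_le_pos; lra]. }
    assert (H3 := Rmult_le_compat_l _ _ _ H1 IH2).
    assert (H4 := Rmult_le_compat_l _ _ _ H2 IH1).
    lra. }
assert (ypos : forall n, (1 <= n)%nat -> 0 < y n).
{ intros [|n] Hn; [lia|]; eapply Rlt_le_trans; [|apply Hlow]; now apply Rmult_lt_0_compat. }
split; [exact ypos|].
set (B := / (1 - Rabs (q / p))).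
assert (HB : 0 < B) by (apply Rinv_0_lt_compat; lra).
apply is_lim_seq_incr_1, is_lim_seq_abs_0.
apply (is_lim_seq_le_le (fun _ => 0) _ (fun n => B / c * (INR (S n) * Rabs (q / p) ^ S n))).
- intros n; split; [apply Rabs_pos|].
  assert (H1 := ypos (S n) ltac:(lia)); assert (H2 := Hlow n); assert (H3 := zpos n).
  unfold Rdiv; rewrite Rabs_mult, Rabs_inv, (Rabs_pos_eq (y (S n))) by lra.
  apply Rle_div_l; [exact H1|].
  assert (HS := laurent_coef_bound d (S n) (q / p) Hd Ht).
  assert (Hb1 := binom_coef_le_1 d (S n) Hd).
  fold B in HS; unfold Rdiv in HS at 2; fold B in HS.
  assert (HS' : Rabs (laurent_coef d (S n) (q / p)) <= B) by nra.
  assert (Hr := rpos (S n)); assert (Hn := pos_INR n).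
  assert (Hqn : 0 <= Rabs q ^ S n) by (apply pow_le, Rabs_pos).
  assert (Hpn : 0 < p ^ S n) by (apply pow_lt; lra).
  apply Rle_trans with (B / c * (INR (S n) * Rabs (q / p) ^ S n) * (c * z n)).
  + unfold minimal_sol; rewrite !Rabs_mult, <- RPow_abs, (Rabs_pos_eq (rising _ _)) by lra.
    apply Rle_trans with (Rabs q ^ S n * rising (1 - d) (S n) * B).
    * apply Rmult_le_compat_l; [apply Rmult_le_pos; lra|exact HS'].
    * right; unfold z, Rdiv at 2; rewrite Rabs_mult, Rabs_inv, (Rabs_pos_eq p), Rpow_mult_distr, pow_inv by lra.
      rewrite S_INR; field; repeat split; lra.
  + apply Rmult_le_compat_l; [|exact H2].
    apply Rmult_le_pos; [left; apply Rdiv_lt_0_compat; lra|].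
    apply Rmult_le_pos; [apply pos_INR|apply pow_le, Rabs_pos].
- apply is_lim_seq_const.
- replace 0 with (B / c * 0) by ring.
  apply is_lim_seq_scal_l with (lu := Finite 0).
  apply -> (is_lim_seq_incr_1 (fun n => INR n * Rabs (q / p) ^ n)).
  apply is_lim_seq_INR_mult_geom; now rewrite Rabs_Rabsolu.
Qed.

(** Pincherle's argument: dividing m = m(0) w + m(1) y by [y] and letting m/y tend to 0 leaves the
    limit of w/y, with m(0) = [laurent_coef d 0 (q / p)] positive. *)
Lemma solution_ratio_limit (p q d : R) (y w : nat -> R) :
  0 < d < 1 -> q <> 0 -> Rabs q < p ->
  solves p q d y -> y O = 0 -> y 1%nat = 1 ->
  solves p q d w -> w O = 1 -> w 1%nat = 0 ->
  (forall n, (1 <= n)%nat -> 0 < y n) /\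
  is_lim_seq (fun n => w n / y n)
    (- (q * (1 - d) * laurent_coef d 1 (q / p) / laurent_coef d 0 (q / p))).
Proof.
intros Hd Hq0 Hqp Hy y0 y1 Hw w0 w1.
assert (Hp : 0 < p) by (assert (H := Rabs_pos q); lra).
assert (Hlim : (forall n, (1 <= n)%nat -> 0 < y n) /\
  is_lim_seq (fun n => minimal_sol p q d n / y n) 0).
{ destruct (Rle_lt_dec 0 q) as [H|H].
  - rewrite Rabs_pos_eq in Hqp by exact H; apply minimal_sol_div_pos; auto; lra.
  - rewrite Rabs_left in Hqp by exact H; apply minimal_sol_div_neg; auto. }
destruct Hlim as [ypos Hlim]; split; [exact ypos|].
assert (Ht : Rabs (q / p) < 1).
{ unfold Rdiv; rewrite Rabs_mult, Rabs_inv, (Rabs_pos_eq p) by lra; apply Rlt_div_l; lra. }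
assert (HS := laurent_coef_0_pos d (q / p) Hd Ht).
assert (HL := solves_lincomb p q d y w _ Hy y0 y1 Hw w0 w1 (minimal_sol_solves p q d Hd Hqp)).
apply is_lim_seq_incr_1.
apply (is_lim_seq_ext (fun n => / laurent_coef d 0 (q / p)
  * (minimal_sol p q d (S n) / y (S n) - q * (1 - d) * laurent_coef d 1 (q / p)))).
- intros n; assert (Hyn := ypos (S n) ltac:(lia)); rewrite HL.
  unfold minimal_sol; simpl; field; lra.
- replace (- (q * (1 - d) * laurent_coef d 1 (q / p) / laurent_coef d 0 (q / p)))
    with (/ laurent_coef d 0 (q / p) * (0 - q * (1 - d) * laurent_coef d 1 (q / p))) by (field; lra).
  apply is_lim_seq_scal_l with (lu := Finite (0 - q * (1 - d) * laurent_coef d 1 (q / p))).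
  apply is_lim_seq_minus'; [|apply is_lim_seq_const].
  now apply -> (is_lim_seq_incr_1 (fun n => minimal_sol p q d n / y n)).
Qed.

(** * The quadratic transformation and the continued fraction *)

(* The substitution [x = 4 t / (1 + t)^2] is the quadratic transformation of the Gauss
   function; it turns the contiguity relations into [legendre_system_unique]. *)
Lemma contiguous_system_quadratic (d : R) (phi phi' psi psi' : R -> R) :
  0 < d < 1 ->
  (forall x, x < 1 -> is_derive phi x (phi' x)) ->
  (forall x, x < 1 -> is_derive psi x (psi' x)) ->
  (forall x, x < 1 -> x * psi' x = (d - 1) / 2 * (phi x - psi x)) ->
  (forall x, x < 1 -> psi' x = (1 - x) * phi' x - d / 2 * phi x) ->
  phi 0 = psi 0 ->
  forall t, -1 < t < 1 -> let x := 4 * t / (1 + t) ^ 2 in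
    x * psi' x * laurent_coef d 0 t = - (1 - d) * t / (1 + t) * laurent_coef d 1 t * phi x /\
    phi x = phi 0 * exp (d * ln (1 + t)) * laurent_coef d 0 t.
Proof.
intros Hd Dphi Dpsi R1 R2 H0.
set (X := fun s : R => 4 * s / (1 + s) ^ 2).
assert (HX : forall s, -1 < s < 1 -> X s < 1).
{ intros s Hs; unfold X; apply Rlt_div_l; [apply pow_lt; lra|nra]. }
assert (DX : forall s, -1 < s < 1 -> is_derive X s (4 * (1 - s) / (1 + s) ^ 3)).
{ intros s Hs; unfold X; auto_derive; [apply Rgt_not_eq; nra|field; lra]. }
(* By the first contiguity relation [u] is x psi'(x) at x = [X s]; in the form of a difference it
   can be differentiated without second derivatives. *)
set (f := fun s => phi (X s)); set (u := fun s => (d - 1) / 2 * (phi (X s) - psi (X s))).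
assert (Df : forall s, -1 < s < 1 -> is_derive f s (4 * (1 - s) / (1 + s) ^ 3 * phi' (X s))).
{ intros s Hs; exact (is_derive_comp phi X s _ _ (Dphi _ (HX s Hs)) (DX s Hs)). }
assert (Dg : forall s, -1 < s < 1 ->
  is_derive (fun s => psi (X s)) s (4 * (1 - s) / (1 + s) ^ 3 * psi' (X s))).
{ intros s Hs; exact (is_derive_comp psi X s _ _ (Dpsi _ (HX s Hs)) (DX s Hs)). }
assert (Du : forall s, -1 < s < 1 -> is_derive u s
  ((d - 1) / 2 * (4 * (1 - s) / (1 + s) ^ 3 * phi' (X s) - 4 * (1 - s) / (1 + s) ^ 3 * psi' (X s)))).
{ intros s Hs; apply is_derive_scal.
  exact (is_derive_minus _ _ _ _ _ (Df s Hs) (Dg s Hs)). }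
(* Eliminating psi' gives u = x ((1-x) phi' - d/2 phi), to be solved for phi'; here x (1-x) = 4 s
   (1-s)^2 / (1+s)^4, whence the exclusion of s = 0. *)
assert (Ephi : forall s, -1 < s < 1 -> s <> 0 ->
  phi' (X s) = (u s + d / 2 * X s * f s) * (1 + s) ^ 4 / (4 * s * (1 - s) ^ 2)).
{ intros s Hs Hs0; assert (E1 := R1 _ (HX s Hs)); assert (E2 := R2 _ (HX s Hs)).
  rewrite E2 in E1; fold (u s) in E1; fold (f s) in E1; rewrite <- E1.
  unfold X at 2 3 5; field; lra. }
assert (Epsi : forall s, -1 < s < 1 -> psi' (X s) = (1 - X s) * phi' (X s) - d / 2 * f s).
{ intros s Hs; exact (R2 _ (HX s Hs)). }
intros t Ht x; fold (X t) in x; unfold x.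
destruct (legendre_system_unique d f u Hd) with (t := t) as [E1 E2].
- intros s Hs; apply derivable_continuous_pt, ex_derive_Reals_0; eexists; now apply Df.
- intros s Hs; apply derivable_continuous_pt, ex_derive_Reals_0; eexists; now apply Du.
- intros s Hs Hs0; assert (D := Df s Hs); rewrite (Ephi s Hs Hs0) in D.
  replace (_ + _) with (4 * (1 - s) / (1 + s) ^ 3 *
    ((u s + d / 2 * X s * f s) * (1 + s) ^ 4 / (4 * s * (1 - s) ^ 2))); [exact D|].
  unfold X; field; lra.
- intros s Hs Hs0; assert (D := Du s Hs); rewrite (Epsi s Hs), (Ephi s Hs Hs0) in D.
  match type of D with is_derive _ _ ?v => replace (_ * _) with v; [exact D|] end.
  unfold X; field; lra.
- unfold u, X; replace (4 * 0 / (1 + 0) ^ 2) with 0 by field; rewrite H0; ring.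
- exact Ht.
- rewrite R1 by now apply HX.
  split; [exact E1|].
  unfold f in E2; rewrite E2; unfold X; replace (4 * 0 / (1 + 0) ^ 2) with 0 by field; reflexivity.
Qed.

(** * Gauss functions on the real half-line below 1 *)

Lemma cut_plane_RtoC (x : R) : x < 1 -> cut_plane (RtoC x).
Proof. intros Hx [_ H]; simpl in H; lra. Qed.

Lemma is_derive_Re_RtoC (F : C -> C) (x : R) :
  analytic_at F (RtoC x) -> is_derive (fun s => Re (F (RtoC s))) x (Re (C_derive F (RtoC x))).
Proof.
intros H; assert (E : forall s : R, (RtoC 0 + RtoC s * RtoC 1 = RtoC s)%C) by (intros; ring).
apply is_derive_ext with (fun s : R => Re (F (RtoC 0 + RtoC s * RtoC 1)%C)).
{ intros s; now rewrite E. }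
assert (D := is_derive_Re_line F 0 1 x); rewrite E, Cmult_1_l in D; now apply D.
Qed.

Lemma is_derive_Im_RtoC (F : C -> C) (x : R) :
  analytic_at F (RtoC x) -> is_derive (fun s => Im (F (RtoC s))) x (Im (C_derive F (RtoC x))).
Proof.
intros H; assert (E : forall s : R, (RtoC 0 + RtoC s * RtoC 1 = RtoC s)%C) by (intros; ring).
apply is_derive_ext with (fun s : R => Im (F (RtoC 0 + RtoC s * RtoC 1)%C)).
{ intros s; now rewrite E. }
assert (D := is_derive_Im_line F 0 1 x); rewrite E, Cmult_1_l in D; now apply D.
Qed.

Lemma Re_scal (s : R) (c : C) : Re (RtoC s * c) = s * Re c.
Proof. destruct c; unfold RtoC, Re; simpl; ring. Qed.

Lemma Im_scal (s : R) (c : C) : Im (RtoC s * c) = s * Im c.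
Proof. destruct c; unfold RtoC, Im; simpl; ring. Qed.

Lemma is_hyp2F1_0 (a b : C) (F : C -> C) : is_hyp2F1 a b 1 F -> F 0 = 1%C.
Proof.
intros [HF _]; apply (is_pseries_C_unique (hyp2F1_coef a b 1) 0).
- apply HF; rewrite Cmod_0; lra.
- assert (H := is_pseries_C_0 (hyp2F1_coef a b 1)).
  replace (hyp2F1_coef a b 1 0) with (RtoC 1) in H; [exact H|].
  unfold hyp2F1_coef; simpl; field.
Qed.

(** The system is linear with real coefficients, so real and imaginary parts solve it separately;
    their values 1 and 0 at the origin show in passing that [F] is real there. *)
Lemma hyp2F1_quadratic (d : R) (F G : C -> C) :
  0 < d < 1 ->
  is_hyp2F1 (RtoC (d / 2)) (RtoC (d / 2 + 1 / 2)) 1 F ->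
  is_hyp2F1 (RtoC (d / 2)) (RtoC (d / 2 + 1 / 2) - 1) 1 G ->
  forall t, -1 < t < 1 -> let x := 4 * t / (1 + t) ^ 2 in
    (RtoC x * C_derive G (RtoC x) * RtoC (laurent_coef d 0 t)
      = RtoC (- (1 - d) * t / (1 + t) * laurent_coef d 1 t) * F (RtoC x))%C /\
    F (RtoC x) = RtoC (exp (d * ln (1 + t)) * laurent_coef d 0 t).
Proof.
intros Hd HF HG t Ht x.
assert (AF : forall y, y < 1 -> analytic_at F (RtoC y)) by (intros; now apply HF, cut_plane_RtoC).
assert (AG : forall y, y < 1 -> analytic_at G (RtoC y)) by (intros; now apply HG, cut_plane_RtoC).
assert (C1 : forall y, y < 1 ->
  (RtoC y * C_derive G (RtoC y) = RtoC ((d - 1) / 2) * (F (RtoC y) - G (RtoC y)))%C).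
{ intros y Hy; rewrite (hyp2F1_contiguity_1 _ _ F G HF HG _ (cut_plane_RtoC y Hy)).
  f_equal; rewrite <- RtoC_minus; f_equal; field. }
assert (C2 : forall y, y < 1 ->
  (C_derive G (RtoC y) = RtoC (1 - y) * C_derive F (RtoC y) - RtoC (d / 2) * F (RtoC y))%C).
{ intros y Hy; rewrite (hyp2F1_contiguity_2 _ _ F G HF HG _ (cut_plane_RtoC y Hy)).
  now rewrite RtoC_minus. }
assert (F0 := is_hyp2F1_0 _ _ _ HF); assert (G0 := is_hyp2F1_0 _ _ _ HG).
destruct (contiguous_system_quadratic d (fun y => Re (F (RtoC y)))
  (fun y => Re (C_derive F (RtoC y))) (fun y => Re (G (RtoC y)))
  (fun y => Re (C_derive G (RtoC y))) Hd) with (t := t) as [E1 E2]; [..|exact Ht|].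
{ intros; now apply is_derive_Re_RtoC, AF. }
{ intros; now apply is_derive_Re_RtoC, AG. }
{ intros; rewrite <- !Re_scal, C1 by assumption; now rewrite Re_scal. }
{ intros; rewrite C2 at 1 by assumption; now rewrite <- !Re_scal. }
{ now rewrite F0, G0. }
destruct (contiguous_system_quadratic d (fun y => Im (F (RtoC y)))
  (fun y => Im (C_derive F (RtoC y))) (fun y => Im (G (RtoC y)))
  (fun y => Im (C_derive G (RtoC y))) Hd) with (t := t) as [E3 E4]; [..|exact Ht|].
{ intros; now apply is_derive_Im_RtoC, AF. }
{ intros; now apply is_derive_Im_RtoC, AG. }
{ intros; rewrite <- !Im_scal, C1 by assumption; now rewrite Im_scal. }
{ intros; rewrite C2 at 1 by assumption; now rewrite <- !Im_scal. }
{ now rewrite F0, G0. }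
rewrite F0 in E2, E4; fold x in E1, E2, E3, E4; simpl in E2, E4.
split.
- rewrite Cmult_comm; apply injective_projections.
  + change (Re (RtoC (laurent_coef d 0 t) * (RtoC x * C_derive G (RtoC x)))
      = Re (RtoC (- (1 - d) * t / (1 + t) * laurent_coef d 1 t) * F (RtoC x)))%C.
    rewrite !Re_scal, <- E1; ring.
  + change (Im (RtoC (laurent_coef d 0 t) * (RtoC x * C_derive G (RtoC x)))
      = Im (RtoC (- (1 - d) * t / (1 + t) * laurent_coef d 1 t) * F (RtoC x)))%C.
    rewrite !Im_scal, <- E3; ring.
- apply injective_projections; simpl.
  + change (fst (F (RtoC x))) with (Re (F (RtoC x))); rewrite E2; ring.
  + change (snd (F (RtoC x))) with (Im (F (RtoC x))); rewrite E4; ring.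
Qed.

(** * Convergents and their limit *)

Fixpoint sol_pair (p q d x0 x1 : R) (n : nat) : R * R :=
  match n with
  | O => (x0, x1)
  | S k => let s := sol_pair p q d x0 x1 k in
      (snd s, (p + q) * (INR k + 1) * snd s - p * q * ((INR k + 1 - d) * (INR k + d)) * fst s)
  end.

(** [sol_pair] carries two consecutive values, so the second order recurrence holds by
    computation. *)
Lemma ex_solves (p q d x0 x1 : R) :
  exists y, solves p q d y /\ y O = x0 /\ y 1%nat = x1.
Proof. exists (fun n => fst (sol_pair p q d x0 x1 n)); repeat split. Qed.

Lemma cf_rec_solves (A K D p q : R) (a1 b0 x0 x1 : C) (y w : nat -> R) :
  D <> 0 -> p + q = A -> p * q = K * D ^ 2 ->
  solves p q (1 / D) y -> y O = 0 -> y 1%nat = 1 ->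
  solves p q (1 / D) w -> w O = 1 -> w 1%nat = 0 ->
  forall n, (cf_rec (cf_a A a1) (cf_b K D b0) x0 x1 n = x0 * RtoC (w n) + x1 * RtoC (y n))%C.
Proof.
intros HD Hs Hp Hy y0 y1 Hw w0 w1 n.
set (r := cf_rec (cf_a A a1) (cf_b K D b0) x0 x1).
enough (H : (r n = x0 * RtoC (w n) + x1 * RtoC (y n))%C /\
  (r (S n) = x0 * RtoC (w (S n)) + x1 * RtoC (y (S n)))%C) by apply H.
induction n as [|n [IH1 IH2]].
{ rewrite y0, y1, w0, w1; unfold r; simpl; split; ring. }
split; [exact IH2|].
change (r (S (S n))) with (RtoC (A * INR (S n)) * r (S n)
  + RtoC (- K * (D * INR (S n) - 1) * (D * INR n + 1)) * r n)%C.
rewrite IH1, IH2, Hy, Hw, Hs, Hp, S_INR.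
(* Extracting D from each factor is what brings in d = 1/D and p q = K D^2. *)
replace (- K * (D * (INR n + 1) - 1) * (D * INR n + 1))
  with (- (K * D ^ 2 * ((INR n + 1 - 1 / D) * (INR n + 1 / D)))) by (field; exact HD).
rewrite !RtoC_minus, !RtoC_opp, !(RtoC_mult _ (w _)), !(RtoC_mult _ (y _)); ring.
Qed.

Open Scope C_scope.

Lemma filterlim_C_intro (u : nat -> C) (l : C) :
  (forall eps : R, (0 < eps)%R -> eventually (fun n => Cmod (u n - l) < eps)%R) ->
  filterlim u eventually (locally l).
Proof.
intros H; apply filterlim_locally; intros eps.
generalize (H eps (cond_pos eps)); apply filter_imp; intros n Hn.
now apply C_NormedModule_mixin_compat1.
Qed.

(** Only boundedness near the limit is needed, to rule out an infinite value; 2 exceeds the sqrt 2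
    that relates balls of [C] to the modulus. *)
Lemma filterlim_C_elim (u : nat -> C) (l : C) :
  filterlim u eventually (locally l) -> eventually (fun n => Cmod (u n - l) < 2)%R.
Proof.
intros H; generalize (proj1 (filterlim_locally _ _) H (mkposreal 1 Rlt_0_1)).
apply filter_imp; intros n Hn.
eapply Rlt_le_trans; [exact (C_NormedModule_mixin_compat2 l (u n) (mkposreal 1 Rlt_0_1) Hn)|].
assert (H2 := Rlt_sqrt2_0); assert (H3 := sqrt_sqrt 2); simpl; nra.
Qed.

Lemma filterlim_C_unique (u : nat -> C) (l l' : C) :
  filterlim u eventually (locally l) -> filterlim u eventually (locally l') -> l = l'.
Proof.
apply (@filterlim_locally_unique nat C_AbsRing C_NormedModule eventually _ u l l').
Qed.

(** The quotient is b0 / (a1 + w/y), whose denominator tends to [v]. If [v = 0] and b0 is not 0, it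
    is unbounded; so a finite limit forces b0 = 0, and then all quotients vanish. *)
Lemma moebius_limit (a1 b0 : C) (y w : nat -> R) (rho : R) :
  (forall n, (1 <= n)%nat -> (0 < y n)%R) ->
  is_lim_seq (fun n => w n / y n)%R rho ->
  let num n := b0 * RtoC (y n) in
  let den n := RtoC (w n) + a1 * RtoC (y n) in
  let v := a1 + RtoC rho in
  (v <> 0 -> eventually (fun n => den n <> 0) /\
     filterlim (fun n => num n / den n) eventually (locally (b0 / v))) /\
  (v = 0 -> forall L : C, eventually (fun n => den n <> 0) ->
     filterlim (fun n => num n / den n) eventually (locally L) -> b0 = 0 /\ L = 0).
Proof.
intros Hy Hlim num den v.
assert (Hev : forall eps : R, (0 < eps)%R ->
  eventually (fun n => (0 < y n)%R /\ den n = RtoC (y n) * (v + RtoC (w n / y n - rho)%R) /\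
    (Rabs (w n / y n - rho) < eps)%R)).
{ intros eps Heps; generalize (proj1 (filterlim_locally _ _) Hlim (mkposreal _ Heps)).
  intros [N HN]; exists (Nat.max 1 N); intros n Hn.
  assert (Hyn := Hy n ltac:(lia)); repeat split; [exact Hyn| |exact (HN n ltac:(lia))].
  assert (Hyn' : RtoC (y n) <> 0) by (intros E; apply RtoC_inj in E; lra).
  unfold den, v; rewrite RtoC_minus, RtoC_div by lra; field; exact Hyn'. }
split.
- intros Hv; assert (Pv : (0 < Cmod v)%R) by now apply Cmod_gt_0.
  assert (Hlow : forall e : R, (Rabs e < Cmod v / 2)%R -> (Cmod v / 2 < Cmod (v + RtoC e))%R).
  { intros e He; assert (T := Cmod_triangle (v + RtoC e) (- RtoC e)).
    replace (v + RtoC e + - RtoC e) with v in T by ring; rewrite Cmod_opp, Cmod_R in T; lra. }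
  split.
  + generalize (Hev (Cmod v / 2)%R ltac:(lra)); apply filter_imp; intros n [Hyn [-> He]].
    apply Cmult_neq_0; [intros E; apply RtoC_inj in E; lra|].
    apply Cmod_gt_0; specialize (Hlow _ He); lra.
  + apply filterlim_C_intro; intros eps Heps.
    set (M := (Cmod b0 + 1)%R); assert (HM : (0 < M)%R) by (assert (H := Cmod_ge_0 b0); unfold M; lra).
    (* The first bound keeps |v + e| above |v| / 2; the second makes the difference, of modulus |b0|
       |e| / (|v + e| |v|), smaller than [eps]. *)
    assert (Hd : (0 < Rmin (Cmod v / 2) (eps * (Cmod v / 2 * Cmod v) / M))%R).
    { apply Rmin_glb_lt; [lra|apply Rdiv_lt_0_compat; [|exact HM]].
      apply Rmult_lt_0_compat; [exact Heps|apply Rmult_lt_0_compat; lra]. }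
    generalize (Hev _ Hd); apply filter_imp; intros n [Hyn [-> He]].
    set (e := (w n / y n - rho)%R) in *.
    assert (He1 := Rlt_le_trans _ _ _ He (Rmin_l _ _)).
    assert (He2 := Rlt_le_trans _ _ _ He (Rmin_r _ _)).
    specialize (Hlow e He1).
    assert (Hyn' : RtoC (y n) <> 0) by (intros E; apply RtoC_inj in E; lra).
    assert (Hve : v + RtoC e <> 0) by (apply Cmod_gt_0; lra).
    unfold num; replace (b0 * RtoC (y n) / (RtoC (y n) * (v + RtoC e)) - b0 / v)
      with (b0 * - RtoC e / ((v + RtoC e) * v)) by (field; auto).
    rewrite Cmod_div, !Cmod_mult, Cmod_opp, Cmod_R by now apply Cmult_neq_0.
    apply Rlt_div_l; [apply Rmult_lt_0_compat; lra|].
    apply Rlt_div_r in He2; [|exact HM].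
    apply Rle_lt_trans with (Rabs e * M)%R.
    * unfold M; assert (H := Rabs_pos e); lra.
    * eapply Rlt_trans; [exact He2|apply Rmult_lt_compat_l; [exact Heps|]].
      apply Rmult_lt_compat_r; lra.
- intros Hv L Hden HL.
  assert (Hb0 : b0 = 0).
  { apply NNPP; intros Hb0; assert (Pb : (0 < Cmod b0)%R) by now apply Cmod_gt_0.
    assert (PL := Cmod_ge_0 L).
    (* With |e| below |b0| / (|L| + 2), the quotient b0 / e has modulus above |L| + 2, although it
       lies within 2 of [L]. *)
    destruct (filter_and _ _ (filter_and _ _ Hden (filterlim_C_elim _ _ HL))
      (Hev (Cmod b0 / (Cmod L + 2))%R ltac:(apply Rdiv_lt_0_compat; lra))) as [N HN].
    destruct (HN N (Nat.le_refl _)) as [[Hd Hb] [Hyn [E He]]].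
    rewrite E in Hd, Hb; rewrite Hv, Cplus_0_l in Hd, Hb.
    set (e := (w N / y N - rho)%R) in *.
    assert (Hyn' : RtoC (y N) <> 0) by (intros E'; apply RtoC_inj in E'; lra).
    assert (He' : RtoC e <> 0) by (intros E'; apply Hd; rewrite E'; ring).
    assert (Pe : (0 < Rabs e)%R) by (rewrite <- Cmod_R; now apply Cmod_gt_0).
    unfold num in Hb; replace (b0 * RtoC (y N) / (RtoC (y N) * RtoC e)) with (b0 / RtoC e) in Hb
      by (field; auto).
    assert (T := Cmod_triangle (b0 / RtoC e - L) L).
    replace (b0 / RtoC e - L + L) with (b0 / RtoC e) in T by ring.
    rewrite Cmod_div, Cmod_R in T by exact He'.
    assert (T' : (Cmod b0 / Rabs e < Cmod L + 2)%R) by lra.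
    apply Rlt_div_l in T'; [|exact Pe]; apply Rlt_div_r in He; lra. }
  split; [exact Hb0|].
  apply (filterlim_C_unique _ _ _ HL).
  apply (filterlim_ext (fun _ => RtoC 0)); [|apply filterlim_const].
  intros n; unfold num; rewrite Hb0; unfold Cdiv; ring.
Qed.

Theorem theorem4p2 :
  forall (A K D : R) (a1 b0 : C) (F G : C -> C),
  (0 < A)%R -> K <> 0%R -> (2 <= D)%R -> (0 < A ^ 2 - 4 * K * D ^ 2)%R ->
  is_hyp2F1 (RtoC (1 / (2 * D))) (RtoC (1 / (2 * D) + 1 / 2)) (RtoC 1) F ->
  is_hyp2F1 (RtoC (1 / (2 * D))) (RtoC (1 / (2 * D) - 1 / 2)) (RtoC 1) G ->
  let x := RtoC (4 * K * D ^ 2 / A ^ 2) in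
  let den := a1 + RtoC A * f_D F G x in
  (* the quotient defining f_D at x is meaningful *)
  F x <> 0 /\
  (* value of the continued fraction, whenever it has a finite limit *)
  (forall L : C, is_cf_limit (cf_a A a1) (cf_b K D b0) L ->
     (b0 <> 0 -> den <> 0) /\ L = b0 / den) /\
  (* the limit does exist, unless the value is infinite *)
  (den <> 0 -> is_cf_limit (cf_a A a1) (cf_b K D b0) (b0 / den)) /\
  (* contiguity relation *)
  (forall z : C, cut_plane z -> F z <> 0 ->
     f_D F G z = - (z / RtoC (2 * D)) + z * (1 - z) * (C_derive F z / F z)).
Proof.
intros A K D a1 b0 F G HA HK HD Hdisc HF HG x den.
set (d := (1 / D)%R).
assert (Hd : (0 < d < 1)%R).
{ unfold d; split; [apply Rdiv_lt_0_compat; lra|apply Rlt_div_l; lra]. }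
assert (Ed : (1 / (2 * D) = d / 2)%R) by (unfold d; field; lra).
assert (EG : RtoC (1 / (2 * D) - 1 / 2) = RtoC (d / 2 + 1 / 2) - 1).
{ rewrite Ed, <- RtoC_minus; f_equal; field. }
rewrite EG in HG; rewrite Ed in HF, HG.
set (s := sqrt (A ^ 2 - 4 * K * D ^ 2)).
assert (Hs : (0 < s)%R) by now apply sqrt_lt_R0.
assert (Hs2 : (s * s = A ^ 2 - 4 * K * D ^ 2)%R) by (apply sqrt_sqrt; lra).
set (p := ((A + s) / 2)%R); set (q := ((A - s) / 2)%R).
assert (Hsum : (p + q = A)%R) by (unfold p, q; field).
assert (Hprod : (p * q = K * D ^ 2)%R) 
  by (replace (p * q)%R with ((A ^ 2 - s * s) / 4)%R by (unfold p, q; field); rewrite Hs2; field).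
assert (Hp : (0 < p)%R) by (unfold p; lra).
assert (HKD : (K * D ^ 2 <> 0)%R).
{ apply Rmult_integral_contrapositive; split; [exact HK|apply pow_nonzero; lra]. }
assert (Hq0 : q <> 0%R) by (intros E; rewrite E in Hprod; lra).
assert (Hqp : (Rabs q < p)%R) by (apply Rabs_def1; unfold p, q; lra).
set (t := (q / p)%R).
assert (Ht : (-1 < t < 1)%R).
{ apply Rabs_def2 in Hqp; unfold t; split; [apply Rlt_div_r|apply Rlt_div_l]; lra. }
(* Both sides are 4 p q / (p + q)^2. *)
assert (Ex : x = RtoC (4 * t / (1 + t) ^ 2)).
{ unfold x; f_equal; unfold t.
  replace (4 * K * D ^ 2)%R with (4 * (p * q))%R by (rewrite Hprod; ring).
  rewrite <- Hsum; field; lra. }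
destruct (hyp2F1_quadratic d F G Hd HF HG t Ht) as [E1 E2]; rewrite <- Ex in E1, E2.
assert (HS : (0 < laurent_coef d 0 t)%R) by (apply laurent_coef_0_pos; [exact Hd|apply Rabs_def1; lra]).
assert (HFx : F x <> 0).
{ rewrite E2; intros E; apply RtoC_inj in E.
  assert (He := exp_pos (d * ln (1 + t))); assert (H := Rmult_lt_0_compat _ _ He HS); lra. }
set (rho := (- (q * (1 - d) * laurent_coef d 1 t / laurent_coef d 0 t))%R).
assert (Eden : den = a1 + RtoC rho).
{ unfold den, f_D; f_equal.
  assert (HS' : RtoC (laurent_coef d 0 t) <> 0) by (intros E; apply RtoC_inj in E; lra).
  replace (x * (C_derive G x / F x))
    with (x * C_derive G x * RtoC (laurent_coef d 0 t) / (RtoC (laurent_coef d 0 t) * F x))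
    by (field; auto).
  rewrite E1.
  replace (RtoC rho) with (RtoC A * (RtoC (- (1 - d) * t / (1 + t) * laurent_coef d 1 t)
    / RtoC (laurent_coef d 0 t))).
  - field; auto.
  - rewrite <- RtoC_div, <- RtoC_mult by lra; f_equal; unfold rho.
    replace A with (p * (1 + t))%R by (rewrite <- Hsum; unfold t; field; lra).
    replace q with (p * t)%R by (unfold t; field; lra); field; lra. }
destruct (ex_solves p q d 0 1) as [y [Hy [y0 y1]]].
destruct (ex_solves p q d 1 0) as [w [Hw [w0 w1]]].
destruct (solution_ratio_limit p q d y w Hd Hq0 Hqp Hy y0 y1 Hw w0 w1) as [ypos Hlim].
fold t in Hlim; fold rho in Hlim.
assert (Hrec := fun x0 x1 => cf_rec_solves A K D p q a1 b0 x0 x1 y w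
  ltac:(lra) Hsum Hprod Hy y0 y1 Hw w0 w1).
assert (Enum : forall n, cf_num (cf_a A a1) (cf_b K D b0) n = b0 * RtoC (y n)).
{ intros n; unfold cf_num; rewrite Hrec; simpl; ring. }
assert (Ecf : forall n, cf_den (cf_a A a1) (cf_b K D b0) n = RtoC (w n) + a1 * RtoC (y n)).
{ intros n; unfold cf_den; rewrite Hrec; simpl; ring. }
assert (Hiff : forall L, is_cf_limit (cf_a A a1) (cf_b K D b0) L <->
  eventually (fun n => RtoC (w n) + a1 * RtoC (y n) <> 0) /\
  filterlim (fun n => b0 * RtoC (y n) / (RtoC (w n) + a1 * RtoC (y n))) eventually (locally L)).
{ intros L; unfold is_cf_limit; split; intros [H1 H2]; split.
  - revert H1; apply filter_imp; intros n; now rewrite Ecf.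
  - revert H2; apply filterlim_ext; intros n; now rewrite Ecf, Enum.
  - revert H1; apply filter_imp; intros n; now rewrite Ecf.
  - revert H2; apply filterlim_ext; intros n; now rewrite Ecf, Enum. }
destruct (moebius_limit a1 b0 y w rho ypos Hlim) as [M1 M2]; rewrite <- Eden in M1, M2.
split; [exact HFx|split; [|split]].
- intros L HL; apply Hiff in HL; destruct (Ceq_dec den 0) as [E|E].
  (* In this degenerate case b0 = 0, so b0 / den is 0 whatever value the total inverse takes at 0,
     in agreement with L = 0. *)
  + destruct HL as [HL1 HL2]; destruct (M2 E L HL1 HL2) as [-> ->].
    split; [now intros H|unfold Cdiv; ring].
  + split; [auto|]; exact (filterlim_C_unique _ _ _ (proj2 HL) (proj2 (M1 E))).
- intros H; apply Hiff, M1, H.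
- intros z Hz Hzn; unfold f_D.
  rewrite (hyp2F1_contiguity_2 _ _ F G HF HG z Hz), <- Ed, RtoC_div by lra.
  assert (H2D : RtoC (2 * D) <> 0) by (intros E; apply RtoC_inj in E; lra).
  field; auto.
Qed.
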